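(* Let $n$ be a positive integer and let $p,q,r$ be nonnegative integers such that $n=p+q+r-1$. Let $A$ be an $(n+1)\times(n+1)$ Hermitian matrix with (counted with multiplicity) $p$ positive eigenvalues $\mu_1,\ldots,\mu_p$, $q$ negative eigenvalues $-\nu_1,\ldots,-\nu_q$ (where each $\nu_j>0$), and $r$ eigenvalues each equal to $0$. Let $\Omega(A)=\{[z]\in\mathbb{CP}^n:\langle Az,z\rangle>0\}$. Then the Riemannian volume of $\Omega(A)\subset\mathbb{CP}^n$ with respect to the Fubini-Study metric is $$\mathrm{Vol}_{\mathrm{FS}}(\Omega(A))=\mathrm{Vol}_{\mathrm{FS}}(\mathbb{CP}^n)\cdot\frac{\mathsf{S}_{(p,q)}(\mu,\nu)}{\mathsf{D}_{(p,q)}(\mu,\nu)},$$ where $\mu=(\mu_1,\dots,\mu_p)$, $\nu=(\nu_1,\dots,\nu_q)$, and $$\mathsf{D}_{(p,q)}(x,y)=\prod_{k=1}^q\prod_{j=1}^p(x_j+y_k),\qquad \mathsf{S}_{(p,q)}(x,y)=\sum_{\lambda\in\mathfrak{C}(p,q)}s_\lambda(x_1,\dots,x_p)\,s_{\lambda^*_{p,q}}(y_1,\dots,y_q).$$ Moreover, each of $\mathsf{S}_{(p,q)}$ and $\mathsf{D}_{(p,q)}$ is a homogeneous polynomial of degree $pq$ in the $p+q$ variables with nonnegative integer coefficients (the zero polynomial being regarded as homogeneous of every degree).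
   Context: For $z\in\mathbb{C}^{n+1}\setminus\{0\}$, $[z]\in\mathbb{CP}^n$ is its class, and $\langle z,w\rangle=\sum_{j=1}^{n+1}z_j\overline{w_j}$. Fubini-Study volume: normalized so that the holomorphic sectional curvature is $4$; explicitly, for measurable $U\subset\mathbb{CP}^n$, $\mathrm{Vol}_{\mathrm{FS}}(U)=\int_{\sigma^{-1}(U)}\frac{dV(\zeta)}{(1+|\zeta|^2)^{n+1}}$, where $\sigma:\mathbb{C}^n\to\mathbb{CP}^n$, $\sigma(\zeta)=[(\zeta_1,\dots,\zeta_n,1)]$, and $dV$ is Lebesgue measure on $\mathbb{C}^n$. In particular $\mathrm{Vol}_{\mathrm{FS}}(\mathbb{CP}^n)=\pi^n/n!$. Partitions: a partition is a non-increasing tuple of nonnegative integers $\lambda_1\ge\lambda_2\ge\cdots$; its parts are its nonzero entries, and partitions with the same parts are identified (so they may be padded with zeros). The empty partition is denoted $0$. $\mathfrak{B}(p,q)$ is the set of partitions with at most $p$ parts, each part being at most $q$. $\mathfrak{C}(p,q)=\{\lambda=(\lambda_1,\dots,\lambda_p)\in\mathfrak{B}(p,q):\lambda_1=q\}$; in particular $\mathfrak{C}(0,q)=\emptyset$ for all $q\ge 0$. The conjugate partition is $\lambda'_k=\#\{j:\lambda_j\ge k\}$. For $\lambda\in\mathfrak{B}(p,q)$, $\lambda^*_{p,q}=(p-\lambda'_q,\dots,p-\lambda'_1)\in\mathfrak{B}(q,p)$ if $q\ge1$, and $\lambda^*_{p,0}=0$. Schur polynomials: for $m\ge1$ and $\lambda$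 a partition with at most $m$ parts, $s_\lambda(x_1,\dots,x_m)=\dfrac{\det(x_\ell^{\lambda_j+m-j})_{1\le j,\ell\le m}}{\prod_{1\le i<j\le m}(x_i-x_j)}$. For the empty partition $s_0\equiv1$ (also in zero variables). Empty products are $1$ and empty sums are $0$. *)

(* Defs.v *)
From HB Require Import structures.
From mathcomp Require Import all_boot all_order all_algebra.
From mathcomp Require Import complex.
(* The notations of mpoly, and some of its names, clash with those of
   analysis, which must come last. *)
From mathcomp Require Import -(notations) mpoly.
From mathcomp Require Import all_classical all_reals all_analysis.

Set Implicit Arguments.
Unset Strict Implicit.
Unset Printing Implicit Defensive.
Import Order.TTheory GRing.Theory Num.Theory.

Local Open Scope classical_set_scope.
Local Open Scope ring_scope.

Definition mvar {K : nzRingType} {m : nat} (i : 'I_m) : mpoly m K :=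
  mpolyX K (mnm1 i).

(* A partition with at most p parts, each at most q, is encoded by its       *)
(* zero-padded p-tuple of entries, which determines it.                      *)
Definition parts (p q : nat) (lam : p.-tuple 'I_q.+1) : seq nat :=
  [seq val x | x <- lam].

Definition frakB (p q : nat) : {set p.-tuple 'I_q.+1} :=
  [set lam | sorted geq (parts lam)].

(* For p = 0 there is no first entry, and the set is empty. *)
Definition frakC (p q : nat) : {set p.-tuple 'I_q.+1} :=
  [set lam in frakB p q | ohead (parts lam) == Some q].

Definition conj_part (lam : seq nat) (k : nat) : nat :=
  count (fun x => k <= x)%N lam.

(* (p - lam'_q, ..., p - lam'_1), which is empty for q = 0. *)
Definition star_part (p q : nat) (lam : seq nat) : seq nat :=
  [seq (p - conj_part lam k)%N | k <- rev (iota 1 q)].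

Section Schur.
Variables (K : idomainType) (m : nat).

(* Rows and columns are numbered from 0, so the exponent lam_j + m - j of    *)
(* the row numbered from 1 becomes lam_j + (m - j.+1).                       *)
Definition alternant (lam : seq nat) : mpoly m K :=
  \det (\matrix_(j < m, l < m) (mvar l ^+ (nth 0%N lam j + (m - j.+1)))).

Definition vandermonde : mpoly m K :=
  \prod_(i < m) \prod_(j < m | (i < j)%N) (mvar i - mvar j).

(* The quotient of the alternant by the Vandermonde product, as a polynomial;*)
(* it exists (schurP) and is unique (schur_unique).                          *)
Definition schur (lam : seq nat) : mpoly m K :=
  xget 0 [set s : mpoly m K | s * vandermonde = alternant lam].

Lemma mvar_inj : injective (@mvar K m).
Proof.
move=> i j /(congr1 (mcoeff (mnm1 i))).
rewrite /mvar !mcoeffX eqxx; case: (mnm1 j =P mnm1 i) => [mE _|_ /eqP].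
  have := congr1 (fun mm : multinom m => mm i) mE.
  by rewrite !mnm1E eqxx; case: eqP.
by rewrite oner_eq0.
Qed.

Let idf (i j : 'I_m) : m.-tuple (mpoly m K) :=
  [tuple mvar (if k == i then j else k) | k < m].

Let idf_mvar i j k : comp_mpoly (idf i j) (mvar k) = mvar (if k == i then j else k).
Proof. by rewrite /mvar comp_mpolyXU -tnth_nth tnth_mktuple. Qed.

Let idf_div i j (f : mpoly m K) :
  exists g, f - comp_mpoly (idf i j) f = (mvar i - mvar j) * g.
Proof.
pose P (f : mpoly m K) :=
  exists g, f - comp_mpoly (idf i j) f = (mvar i - mvar j) * g.
have PD f1 f2 : P f1 -> P f2 -> P (f1 + f2).
  move=> [g1 e1] [g2 e2]; exists (g1 + g2).
  by rewrite mulrDr -e1 -e2 rmorphD /= opprD addrACA.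
have PM f1 f2 : P f1 -> P f2 -> P (f1 * f2).
  move=> [g1 e1] [g2 e2]; exists (g1 * f2 + comp_mpoly (idf i j) f1 * g2).
  rewrite mulrDr mulrA -e1 mulrCA -e2 rmorphM /= mulrBl mulrBr.
  by rewrite addrA subrK.
have PC c : P (mpolyC m c) by exists 0; rewrite comp_mpolyC subrr mulr0.
have P1 : P 1 by rewrite -[1]/(mpolyC m 1).
have PX k : P (mvar k).
  rewrite /P idf_mvar; case: eqP => [->|_]; first by exists 1; rewrite mulr1.
  by exists 0; rewrite subrr mulr0.
have PXn k e : P (mvar k ^+ e).
  by elim: e => [|e ih]; rewrite ?expr0// exprS; apply: (PM) => //; exact: PX.
have P0 : P 0 by rewrite -(mpolyC0 m); exact: PC.
rewrite [f]mpolyE; apply: (big_ind P P0 PD) => mm _.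
rewrite -mul_mpolyC; apply: (PM); first exact: PC.
by rewrite mpolyXE_id; apply: (big_ind P P1 PM) => k _; exact: PXn.
Qed.

Let idf_alternant i j lam : i != j -> comp_mpoly (idf i j) (alternant lam) = 0.
Proof.
move=> ij; rewrite /alternant -det_map_mx -det_tr.
apply: (determinant_alternate ij) => l; rewrite !mxE !rmorphXn /= !idf_mvar.
by rewrite eqxx eq_sym (negbTE ij).
Qed.

Lemma vandermonde_neq0 : vandermonde != 0.
Proof.
apply/prodf_neq0 => i _; apply/prodf_neq0 => j ij.
by rewrite subr_eq0; apply: contraTneq ij => /mvar_inj ->; rewrite ltnn.
Qed.

Lemma schur_exists lam : exists s, s * vandermonde = alternant lam.
Proof.
suff H (s : seq ('I_m * 'I_m)) : uniq s -> all (fun x : 'I_m * 'I_m => x.1 < x.2)%N s ->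
    exists g, g * \prod_(x <- s) (mvar x.1 - mvar x.2) = alternant lam.
  have [||g gE] := H (enum [pred x : 'I_m * 'I_m | (x.1 < x.2)%N]).
  - exact: enum_uniq.
  - by apply/allP => x; rewrite mem_enum.
  - exists g; rewrite -gE big_enum /vandermonde pair_big_dep /=.
    by congr (_ * _); apply: eq_bigl => x.
elim: s => [_ _|[i j] s ih /= /andP[ijs us] /andP[ij als]].
  by exists (alternant lam); rewrite big_nil mulr1.
have [g gE] := ih us als.
have nij : i != j by apply: contraTneq ij => ->; rewrite ltnn.
have [h hE] := idf_div i j g.
suff g0 : comp_mpoly (idf i j) g = 0.
  exists h; rewrite big_cons /= mulrA [h * _]mulrC -hE g0 subr0; exact: gE.
have := idf_alternant lam nij; rewrite -gE rmorphM rmorph_prod /= => /eqP.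
rewrite mulf_eq0 => /orP[/eqP //|]; rewrite prodf_seq_eq0 => /hasP[[a b] abs /=].
have /= ab := allP als _ abs.
rewrite rmorphB /= !idf_mvar subr_eq0 => /eqP /mvar_inj.
have nab : a != b by apply: contraTneq ab => ->; rewrite ltnn.
case: (eqVneq a i) => [ai|_]; case: (eqVneq b i) => [bi|_] E.
- by rewrite ai bi eqxx in nab.
- by rewrite ai -E (negbTE ijs) in abs.
- by move: ab; rewrite E bi ltnNge ltnW.
- by rewrite E eqxx in nab.
Qed.

Lemma schurP lam : schur lam * vandermonde = alternant lam.
Proof.
have [s sE] := schur_exists lam.
exact: (@xgetPex _ 0 [set s | s * vandermonde = alternant lam]) (ex_intro _ s sE).
Qed.

Lemma schur_unique lam (s : mpoly m K) :
  s * vandermonde = alternant lam -> s = schur lam.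
Proof. by rewrite -schurP => /(mulIf vandermonde_neq0). Qed.

End Schur.

(* In the polynomial ring in p + q variables, the first p variables are the  *)
(* x_j and the last q are the y_k.                                           *)
Section SD.
Variables (K : idomainType) (p q : nat).

Definition xvar (j : 'I_p) : mpoly (p + q) K := mvar (lshift q j).
Definition yvar (k : 'I_q) : mpoly (p + q) K := mvar (rshift p k).

Definition Dpoly : mpoly (p + q) K :=
  \prod_(k < q) \prod_(j < p) (xvar j + yvar k).

Definition Spoly : mpoly (p + q) K :=
  \sum_(lam in frakC p q)
     comp_mpoly [tuple xvar j | j < p] (schur K p (parts lam))
   * comp_mpoly [tuple yvar k | k < q] (schur K q (star_part p q (parts lam))).

End SD.

(* m1 \x m2 under a name of its own: on product_measure1 the inference of    *)
(* sigma-finiteness is captured by an instance for subprobabilities.         *)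
Section sigma_prod.
Context d1 d2 (T1 : measurableType d1) (T2 : measurableType d2) (R : realType).
Variables (m1 : {sigma_finite_measure set T1 -> \bar R}).
Variables (m2 : {sigma_finite_measure set T2 -> \bar R}).

Definition sigma_prod : set (T1 * T2)%type -> \bar R := (m1 \x m2)%E.

HB.instance Definition _ := Measure.copy sigma_prod (m1 \x m2)%E.

Let sigma_prod_sigma_finite : sigma_finite setT sigma_prod.
Proof.
have /sigma_finiteP[F [TF ndF Foo]] := sigma_finiteT m1.
have /sigma_finiteP[G [TG ndG Goo]] := sigma_finiteT m2.
exists (fun n => F n `*` G n).
  rewrite -setXTT TF TG predeqE => -[x y]; split.
    move=> [/= [n _ Fnx] [k _ Gky]]; exists (maxn n k) => //; split.
    - by move: x Fnx; exact/subsetPset/ndF/leq_maxl.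
    - by move: y Gky; exact/subsetPset/ndG/leq_maxr.
  by move=> [n _ []/= ? ?]; split; exists n.
move=> k; have [? ?] := Foo k; have [? ?] := Goo k.
split; first exact: measurableX.
by rewrite /sigma_prod product_measure1E// lte_mul_pinfty// ge0_fin_numE.
Qed.

HB.instance Definition _ := Measure_isSigmaFinite.Build _ _ _ sigma_prod
  sigma_prod_sigma_finite.

End sigma_prod.

Section tuple_measure.
Context d (T : measurableType d) (R : realType).

Definition tcons n (x : (T * n.-tuple T)%type) : n.+1.-tuple T :=
  [tuple of x.1 :: x.2].

Lemma measurable_tcons n : measurable_fun setT (@tcons n).
Proof.
exact: (@measurable_cons _ _ _ T fst n snd measurable_fst measurable_snd).
Qed.

Section push.
Variables (n : nat) (mu : {sigma_finite_measure set (T * n.-tuple T)%type -> \bar R}).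

Definition tcons_measure := pushforward mu (@tcons n).

Let tcons0 : tcons_measure set0 = 0%E.
Proof. by rewrite /tcons_measure /pushforward preimage_set0 measure0. Qed.

Let tcons_ge0 A : (0 <= tcons_measure A)%E.
Proof. by rewrite /tcons_measure /pushforward measure_ge0. Qed.

Let tcons_sigma_additive : semi_sigma_additive tcons_measure.
Proof.
move=> F mF tF mUF; rewrite /tcons_measure /pushforward preimage_bigcup.
apply: measure_semi_sigma_additive.
- by move=> k; rewrite -[X in measurable X]setTI; exact: measurable_tcons.
- by apply/trivIsetP => i j _ _ ij; rewrite -preimage_setI;
    move/trivIsetP: tF => ->//; rewrite preimage_set0.
- rewrite -preimage_bigcup -[X in measurable X]setTI.
  exact: measurable_tcons.
Qed.

HB.instance Definition _ := isMeasure.Build _ _ _ tcons_measure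
  tcons0 tcons_ge0 tcons_sigma_additive.

Let tcons_sigma_finite : sigma_finite setT tcons_measure.
Proof.
have [F FT Foo] := sigma_finiteT mu.
pose s (t : n.+1.-tuple T) : (T * n.-tuple T)%type := (thead t, [tuple of behead t]).
have tcK (x : (T * n.-tuple T)%type) : s (tcons x) = x.
  case: x => a b; congr pair; exact: val_inj.
exists (fun k => s @^-1` F k).
  by rewrite -preimage_bigcup -FT preimage_setT.
move=> k; have [mF Fk] := Foo k; split.
  rewrite -[X in measurable X]setTI.
  have ms : measurable_fun setT s.
    apply: measurable_fun_pair; first exact: measurable_tnth.
    exact: measurable_behead.
  exact: ms.
rewrite /tcons_measure /pushforward.
suff -> : @tcons n @^-1` (s @^-1` F k) = F k by [].
by apply/seteqP; split=> x /=; rewrite tcK.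
Qed.

HB.instance Definition _ := Measure_isSigmaFinite.Build _ _ _ tcons_measure
  tcons_sigma_finite.

End push.

(* The n-fold product measure; tuple_measure_box gives its value on boxes. *)
Fixpoint tuple_measure (mu : {sigma_finite_measure set T -> \bar R}) (n : nat) :
    {sigma_finite_measure set (n.-tuple T) -> \bar R} :=
  match n with
  | 0%N => \d_([tuple] : 0.-tuple T)
  | n'.+1 => tcons_measure (sigma_prod mu (tuple_measure mu n'))
  end.

Lemma tuple_measure_box (mu : {sigma_finite_measure set T -> \bar R}) n
    (A : 'I_n -> set T) : (forall i, measurable (A i)) ->
  tuple_measure mu n [set t | forall i, A i (tnth t i)] =
  (\prod_(i < n) mu (A i))%E.
Proof.
elim: n A => [|n ih] A mA.
  by rewrite big_ord0 /= diracE mem_set//; case.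
rewrite big_ord_recl -ih// /= /tcons_measure /pushforward.
have -> : @tcons n @^-1` [set t | forall i, A i (tnth t i)] =
    A ord0 `*` [set t | forall i, A (lift ord0 i) (tnth t i)].
  apply/seteqP; split=> -[a t] /= H.
    by split=> [|i]; [exact: (H ord0)|have := H (lift ord0 i); rewrite tnthS].
  move=> i; case: (unliftP ord0 i) => [j|] ->; last exact: H.1.
  by rewrite tnthS; exact: H.2.
rewrite /sigma_prod product_measure1E//.
have -> : [set t : n.-tuple T | forall i, A (lift ord0 i) (tnth t i)] =
    \bigcap_(i in [set: 'I_n]) ((@tnth n T)^~ i @^-1` A (lift ord0 i)).
  by apply/seteqP; split=> t /= H i => [_|]; exact: H.
apply: fin_bigcap_measurable => // i _; rewrite -[X in measurable X]setTI.
exact: measurable_tnth.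
Qed.

End tuple_measure.

(* C^n is identified with (R^2)^n as a measurable space; complex_of turns a  *)
(* coordinate into the complex number it stands for.                         *)
Notation Cspace R n :=
  (n.-tuple (measurableTypeR R * measurableTypeR R)%type).

Definition complex_of (R : realType)
  (x : (measurableTypeR R * measurableTypeR R)%type) : R[i] := Complex x.1 x.2.

Definition lebesgueC (R : realType) (n : nat) :
    {sigma_finite_measure set (Cspace R n) -> \bar R} :=
  tuple_measure (sigma_prod (@lebesgue_measure R) (@lebesgue_measure R)) n.

Section CP.
Variables (R : realType) (n : nat).

Definition herm (z w : 'cV[R[i]]_n.+1) : R[i] :=
  \sum_(j < n.+1) z j 0 * (w j 0)^*.

Definition nzvec := {z : 'cV[R[i]]_n.+1 | z != 0}.

(* Such a c is automatically nonzero. *)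
Definition proj_eq (z w : nzvec) : bool :=
  `[< exists c : R[i], val w = c *: val z >].

Lemma proj_eq_equiv : equiv_class_of proj_eq.
Proof.
split=> [z|z w|w z t].
- by apply/asboolP; exists 1; rewrite scale1r.
- have sym (x y : nzvec) : proj_eq x y -> proj_eq y x.
    move=> /asboolP[c yE]; apply/asboolP; exists c^-1.
    have c0 : c != 0.
      by apply: contraNneq (valP y) => c0; rewrite yE c0 scale0r.
    by rewrite yE scalerA mulVf// scale1r.
  by apply/idP/idP; exact: sym.
- move=> /asboolP[c wE] /asboolP[e tE]; apply/asboolP; exists (e * c).
  by rewrite tE wE scalerA.
Qed.

Canonical proj_eq_equivRel := EquivRelPack proj_eq_equiv.

Definition CP : Type := {eq_quot proj_eq}%qT.

Definition cls (z : nzvec) : CP := (\pi_({eq_quot proj_eq}) z)%qT.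

Lemma clsP (z w : nzvec) :
  cls z = cls w <-> exists c : R[i], val w = c *: val z.
Proof.
split=> [/(@eqmodP _ proj_eq_equivRel)/asboolP //|H].
exact/(@eqmodP _ proj_eq_equivRel)/asboolP.
Qed.

(* sigma zeta = [(zeta_1, ..., zeta_n, 1)] *)
Definition sigma_vec (zeta : Cspace R n) : 'cV[R[i]]_n.+1 :=
  \col_(i < n.+1) if unlift ord_max i is Some j
                  then complex_of (tnth zeta j) else 1.

Lemma sigma_vec_neq0 zeta : sigma_vec zeta != 0.
Proof.
apply/eqP => /matrixP/(_ ord_max 0); rewrite !mxE unlift_none => /eqP.
by rewrite oner_eq0.
Qed.

Definition sigma (zeta : Cspace R n) : CP :=
  cls (exist _ (sigma_vec zeta) (sigma_vec_neq0 zeta)).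

Definition normsq (zeta : Cspace R n) : R :=
  \sum_(j < n) ((tnth zeta j).1 ^+ 2 + (tnth zeta j).2 ^+ 2).

Definition VolFS (U : set CP) : \bar R :=
  (\int[lebesgueC R n]_(zeta in sigma @^-1` U)
     (((1 + normsq zeta) ^+ n.+1)^-1)%:E)%E.

(* In R[i], 0 < w means that w is real and positive; for Hermitian A the     *)
(* number <Az, z> is always real.                                            *)
Definition Omega (A : 'M[R[i]]_n.+1) : set CP :=
  [set cls z | z in [set z : nzvec | 0 < herm (A *m val z) (val z)]].

End CP.

(* Main.v *)
Require Import Defs.
From HB Require Import structures.
From mathcomp Require Import all_boot all_order all_algebra.
From mathcomp Require Import perm fingroup fraction complex.
From mathcomp Require Import -(notations) mpoly.
From mathcomp Require Import all_classical all_reals all_analysis.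
From mathcomp Require Import measurable_realfun.
From mathcomp Require Import ring lra zify.
Set Implicit Arguments.
Unset Strict Implicit.
Unset Printing Implicit Defensive.
Import Order.TTheory GRing.Theory Num.Theory.
Import numFieldNormedType.Exports.
Local Open Scope classical_set_scope.
Local Open Scope ring_scope.

(** A Gaussian vector of C^(n+1) projects to a multiple of the Fubini-Study volume
    and is invariant under unitary maps, so after diagonalization the volume ratio is
    P(sum_j mu_j E_j > sum_k nu_k F_k) for independent standard exponential variables,
    the [|z_i|^2] of the Gaussian coordinates. By lack of memory, mu_1 E_1 - nu_1 F_1 is
    distributed as mu_1 E with probability mu_1 / (mu_1 + nu_1) and as - nu_1 F with
    probability nu_1 / (mu_1 + nu_1), which determines the ratio by a recursion removing
    one eigenvalue at a time, whether or not the eigenvalues are distinct.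

    On the algebraic side, expanding each alternant along its first row reduces S, for
    generic variables, to D * sum_i x_i^(p+q-1) / (prod_(j != i) (x_i - x_j) *
    prod_k (x_i + y_k)), by the dual Cauchy identity. This sum satisfies the same
    recursion, and the recursion exhibits S as a homogeneous polynomial with nonnegative
    integer coefficients. *)

(** * Recursive numerator and denominator; Lagrange sums *)

(** Two constants, [disc_area] (which is pi) and [kappa] (which is pi * n!), are never evaluated.
    They are the same for Omega and for the whole space, so it is enough that they are positive and
    finite. No Jacobian determinant is computed either: a surjective additive map rescales a
    translation-invariant measure by a constant, which is read off from a single test set. The
    Lagrange sum has a pole wherever two of the x_i coincide, so it is never evaluated at
    eigenvalues. It is used only at indeterminates, in a fraction field, to identify S with
    [vol_num]. The latter is defined without division, which makes it the meeting point of the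
    algebra and the probability. Only the event that the signed sum exceeds 0 is wanted, but the
    rule for a pair has to be integrated over the remaining variables. The probability of exceeding
    an arbitrary threshold t is therefore tracked throughout. *)

Fixpoint vol_num (F : comNzRingType) (xs : seq F) : seq F -> F :=
  fix vol_num_xs (ys : seq F) : F :=
  match xs, ys with
  | [::], _ => 0
  | _ :: _, [::] => 1
  | x :: xs', y :: ys' =>
      x * vol_num_xs ys' * \prod_(x' <- xs') (x' + y)
      + y * vol_num xs' ys * \prod_(y' <- ys') (x + y')
  end.
Arguments vol_num : simpl never.

Definition vol_den (F : comNzRingType) (xs ys : seq F) : F :=
  \prod_(y <- ys) \prod_(x <- xs) (x + y).

Section VolNum.
Variable F : comNzRingType.
Implicit Types xs ys : seq F.

Lemma vol_num_nil ys : vol_num [::] ys = 0.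
Proof. by case: ys. Qed.

Lemma vol_num_cons_nil x xs : vol_num (x :: xs) [::] = 1.
Proof. by []. Qed.

(** With r = vol_num / vol_den, this is r(x::xs, y::ys) = x/(x+y) r(x::xs, ys) + y/(x+y) r(xs,
    y::ys) multiplied by the denominator of the left side, in which x + y cancels. The base values
    are probabilities too: 0 when there is no positive term, 1 when there are positive terms
    only. *)
Lemma vol_num_cons x xs y ys : vol_num (x :: xs) (y :: ys) =
  x * vol_num (x :: xs) ys * \prod_(x' <- xs) (x' + y)
  + y * vol_num xs (y :: ys) * \prod_(y' <- ys) (x + y').
Proof. by []. Qed.

Lemma vol_num_ind (P : seq F -> seq F -> Prop) :
  (forall ys, P [::] ys) -> (forall x xs, P (x :: xs) [::]) ->
  (forall x xs y ys, P (x :: xs) ys -> P xs (y :: ys) -> P (x :: xs) (y :: ys)) ->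
  forall xs ys, P xs ys.
Proof.
move=> P0 P1 PS; elim=> [//|x xs IHx]; elim=> [//|y ys IHy]; exact: PS.
Qed.

Lemma vol_den_consl x xs ys :
  vol_den (x :: xs) ys = \prod_(y <- ys) (x + y) * vol_den xs ys.
Proof.
by rewrite /vol_den -big_split; apply: eq_bigr => y _; rewrite big_cons.
Qed.

Lemma vol_den_consr xs y ys :
  vol_den xs (y :: ys) = \prod_(x <- xs) (x + y) * vol_den xs ys.
Proof. by rewrite /vol_den big_cons. Qed.

End VolNum.

Lemma rmorph_vol_num (F G : comNzRingType) (f : {rmorphism F -> G}) xs ys :
  f (vol_num xs ys) = vol_num (map f xs) (map f ys).
Proof.
elim/vol_num_ind: xs / ys => [ys|x xs|x xs y ys IH1 IH2].
- by rewrite !vol_num_nil rmorph0.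
- by rewrite rmorph1.
- rewrite vol_num_cons rmorphD !rmorphM IH1 IH2 /= vol_num_cons !rmorph_prod !big_map.
  by congr (_ * _ * _ + _ * _ * _); apply: eq_bigr => i _; rewrite rmorphD.
Qed.

Lemma rmorph_vol_den (F G : comNzRingType) (f : {rmorphism F -> G}) xs ys :
  f (vol_den xs ys) = vol_den (map f xs) (map f ys).
Proof.
rewrite /vol_den rmorph_prod big_map; apply: eq_bigr => y _.
by rewrite rmorph_prod big_map; apply: eq_bigr => x _; rewrite rmorphD.
Qed.

Section Field.
Variable F : fieldType.
Implicit Types xs ys zs : seq F.

(** At a member [z] of a duplicate-free list this is the derivative of prod_w (X - w). Excluding by
    value rather than by position makes it nonzero for all [zs] and [z]. *)
Definition nodal zs (z : F) : F := \prod_(w <- zs | w != z) (z - w).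

Lemma perm_nodal zs zs' z : perm_eq zs zs' -> nodal zs z = nodal zs' z.
Proof. exact: perm_big. Qed.

Lemma nodal_neq0 zs z : nodal zs z != 0.
Proof.
rewrite prodf_seq_neq0; apply/allP => w _ /=; apply/implyP => wz.
by rewrite subr_eq0 eq_sym.
Qed.

Lemma nodal_cons_neq z0 zs z : z0 != z -> nodal (z0 :: zs) z = (z - z0) * nodal zs z.
Proof. by move=> h; rewrite /nodal big_cons h. Qed.

Lemma nodal_cons_eq zs z : nodal (z :: zs) z = nodal zs z.
Proof. by rewrite /nodal big_cons eqxx. Qed.

Definition lagr zs : F := \sum_(z <- zs) z ^+ (size zs).-1 / nodal zs z.

(** The sum is the divided difference of X^(k-1) at k nodes, hence the leading coefficient of that
    monomial. The induction is the usual recurrence, which merges two lists that differ in one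
    node. *)
Lemma lagr1 zs : uniq zs -> zs != [::] -> lagr zs = 1.
Proof.
have [n] := ubnP (size zs); elim: n zs => [//|n IH] [//|x1 [|x2 zs]] sz.
  move=> _ _; rewrite /lagr big_seq1 /= expr0 nodal_cons_eq /nodal big_nil.
  exact: divr1.
move=> /= /andP[]; rewrite inE negb_or => /andP[x12 x1z] /andP[x2z uz] _.
have IH1 : lagr (x1 :: zs) = 1 by apply: IH => //=; rewrite x1z.
have IH2 : lagr (x2 :: zs) = 1 by apply: IH => //=; rewrite x2z.
have x12' : x1 - x2 != 0 by rewrite subr_eq0.
apply: (mulfI x12'); rewrite mulr1.
(* Term by term this is z (x1 - x2) = x1 (z - x2) - x2 (z - x1). *)
suff : (x1 - x2) * lagr [:: x1, x2 & zs] =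
    x1 * lagr (x1 :: zs) - x2 * lagr (x2 :: zs) by rewrite IH1 IH2 !mulr1.
rewrite /lagr /= !big_cons !mulrDr !mulr_sumr.
rewrite !nodal_cons_eq.
have x21 : x2 != x1 by rewrite eq_sym.
rewrite (nodal_cons_neq _ x12) (nodal_cons_neq _ x21) !nodal_cons_eq.
have [n1 n2] := (nodal_neq0 zs x1, nodal_neq0 zs x2).
have E : \sum_(i <- zs) (x1 - x2) * (i ^+ (size zs).+1 / nodal [:: x1, x2 & zs] i) =
  \sum_(i <- zs) x1 * (i ^+ size zs / nodal (x1 :: zs) i) -
  \sum_(i <- zs) x2 * (i ^+ size zs / nodal (x2 :: zs) i).
  rewrite -sumrB [LHS]big_seq [RHS]big_seq; apply: eq_bigr => z zz.
  have z1 : x1 != z by apply: contraNneq x1z => ->.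
  have z2 : x2 != z by apply: contraNneq x2z => ->.
  rewrite !nodal_cons_neq//.
  have nz := nodal_neq0 zs z.
  have z1' : z - x1 != 0 by rewrite subr_eq0 eq_sym.
  have z2' : z - x2 != 0 by rewrite subr_eq0 eq_sym.
  by rewrite exprS; field; rewrite z1' z2' nz.
rewrite E !exprS.
have x21' : x2 - x1 != 0 by rewrite subr_eq0 eq_sym.
by field; rewrite n1 n2 x12' x21'.
Qed.

(** * Vandermonde products and Schur functions at distinct points *)

Fixpoint vand zs : F :=
  if zs is z :: zs' then \prod_(w <- zs') (z - w) * vand zs' else 1.

Lemma vand_cat_cons s1 x s2 :
  vand (s1 ++ x :: s2) = (-1) ^+ size s1 * vand (x :: s1 ++ s2).
Proof.
elim: s1 => [|w s1 IH] /=; first by rewrite expr0 mul1r.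
rewrite IH /= !(big_cat, big_cons) /= exprS; ring.
Qed.

Lemma vandE m (zs : seq F) : size zs = m ->
  vand zs = \prod_(i < m) \prod_(j < m | (i < j)%N) (zs`_i - zs`_j).
Proof.
elim: m zs => [|m IH] [//|z zs] //=; first by rewrite big_ord0.
move=> [sz]; rewrite big_ord_recl (IH _ sz) (big_nth 0) sz big_mkord /=.
congr (_ * _); first by rewrite [RHS]big_mkcond big_ord_recl /= mul1r.
by apply: eq_bigr => i _; rewrite [RHS]big_mkcond big_ord_recl /= mul1r -big_mkcond.
Qed.

(** Moving entry i to the front reverses i differences, and the differences that contain it then
    form the nodal product. *)
Lemma vand_rem zs (i : nat) : uniq zs -> (i < size zs)%N ->
  vand zs = (-1) ^+ i * (nodal zs zs`_i * vand (rem zs`_i zs)).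
Proof.
move=> uz iz; have sti : size (take i zs) = i by rewrite size_take iz.
rewrite -{1}(cat_take_drop i zs) (drop_nth 0 iz) vand_cat_cons /= remE.
rewrite index_uniq// sti; congr (_ * (_ * _)).
have P : perm_eq zs (zs`_i :: rem zs`_i zs) by rewrite perm_to_rem// mem_nth.
rewrite (perm_nodal _ P) nodal_cons_eq remE index_uniq// /nodal.
rewrite [RHS]big_seq_cond [LHS]big_seq; apply: eq_bigl => w.
have := perm_uniq P; rewrite uz remE index_uniq//= => /esym/andP[h _].
by case: (boolP (w \in _)) => // wz; apply/esym; apply: contraNneq h => <-.
Qed.

(** The Schur function at distinct points: the alternant expanded along its first row and divided by
    the Vandermonde product. The exponent is lambda_1 + m - 1, where m is the number of parts,
    padding included. *)
Fixpoint sch (lam : seq nat) (xs : seq F) : F :=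
  if lam is a :: lam' then
    \sum_(x <- xs) x ^+ (a + size lam') / nodal xs x * sch lam' (rem x xs)
  else 1.

Lemma det_alternant m (lam : seq nat) (xs : seq F) :
  size lam = m -> size xs = m -> uniq xs ->
  \det (\matrix_(j < m, l < m) (xs`_l ^+ (nth 0%N lam j + (m - j.+1))))
  = sch lam xs * vand xs.
Proof.
elim: m lam xs => [|m IH] [|a lam] // xs.
  by move=> _ /size0nil ->; rewrite det_mx00 /= mulr1.
move=> [sl] sx ux; rewrite (expand_det_row _ ord0) /= [in RHS](big_nth 0) sx big_mkord.
rewrite mulr_suml; apply: eq_bigr => i _.
have ix : (i < size xs)%N by rewrite sx.
rewrite mxE /cofactor /= subSS subn0 sl add0n.
(* The sign produced here equals the sign of the cofactor in column [i] of the first row. *)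
rewrite (vand_rem ux ix).
have nz := nodal_neq0 xs xs`_i.
have -> : \det (row' ord0 (col' i
   (\matrix_(j < m.+1, l < m.+1) (xs`_l ^+ (nth 0%N (a :: lam) j + (m.+1 - j.+1)))))) =
   sch lam (rem xs`_i xs) * vand (rem xs`_i xs).
  have srem : size (rem xs`_i xs) = m by rewrite size_rem ?mem_nth ?sx.
  rewrite -(IH lam) ?rem_uniq//.
  congr (\det _); apply/matrixP => j k; rewrite !mxE /= subSS; congr (_ ^+ _).
  rewrite remE index_uniq// nth_cat size_take ix /bump.
  by case: ltnP => ki; [rewrite nth_take|rewrite nth_drop addSn subnKC].
by field.
Qed.

End Field.

(** * Dual Cauchy identity *)

(** The zero-padded elements of B(p, q), split according to whether the first part equals q. The two
    halves of [sum_lagr] follow the same split, and its first half is [boxC]. *)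
Fixpoint box (p : nat) : nat -> seq (seq nat) :=
  fix box_p (q : nat) :=
  match p, q with
  | 0, _ => [:: [::]]
  | _.+1, 0 => [:: nseq p 0%N]
  | p'.+1, q'.+1 => map (cons q) (box p' q) ++ box_p q'
  end.
Arguments box : simpl never.

Definition boxC (p q : nat) : seq (seq nat) :=
  if p is p'.+1 then map (cons q) (box p' q) else [::].

Lemma boxSS p q : box p.+1 q.+1 = map (cons q.+1) (box p q.+1) ++ box p.+1 q.
Proof. by []. Qed.

Lemma box0 q : box 0 q = [:: [::]].
Proof. by case: q. Qed.

Lemma box_ind (P : nat -> nat -> Prop) :
  (forall q, P 0%N q) -> (forall p, P p.+1 0%N) ->
  (forall p q, P p q.+1 -> P p.+1 q -> P p.+1 q.+1) -> forall p q, P p q.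
Proof.
move=> P0 P1 PS; elim=> [//|p IHp]; elim=> [//|q IHq]; exact: PS.
Qed.

Lemma mem_box p q lam :
  (lam \in box p q) = [&& size lam == p, sorted geq lam & all (leq^~ q) lam].
Proof.
elim/box_ind: p / q lam => [q|p|p q IHp IHq] lam.
- by rewrite box0 inE; case: lam.
- rewrite inE; apply/eqP/and3P => [->|[/eqP sl _ al]].
    rewrite size_nseq eqxx; split=> //; last by rewrite all_nseq.
    by elim: p => //= p ->.
  rewrite -sl; apply/all_pred1P; apply: sub_all al => x /=.
  by rewrite leqn0.
- rewrite boxSS mem_cat IHq; apply/orP/and3P.
    move=> [/mapP[l]|/and3P[sl srt al]].
      rewrite IHp => /and3P[/eqP sl srt al] ->; split=> /=; first by rewrite sl.
        by rewrite path_min_sorted.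
      by rewrite leqnn.
    by split=> //; apply: sub_all al => x /leqW.
  case: lam => [[]//|a l] [/= /eqP[sl] srt /andP[aq al]].
  move: (aq); rewrite leq_eqVlt => /orP[/eqP aE|aq']; [left|right].
    apply/mapP; exists l; last by rewrite aE.
    by rewrite IHp sl eqxx al (path_sorted srt).
  rewrite sl eqxx srt /=; apply/andP; split; first by [].
  have := order_path_min (rev_trans leq_trans) srt.
  by apply: sub_all => x /= /leq_trans; apply.
Qed.

Lemma uniq_box p q : uniq (box p q).
Proof.
elim/box_ind: p / q => [q|p|p q IHp IHq]; rewrite ?box0// boxSS cat_uniq IHq.
rewrite map_inj_uniq ?IHp ?andTb ?andbT; last by move=> ? ? [].
apply/hasPn => l; rewrite mem_box => /and3P[_ _ al].
by apply/mapP => -[l' _ lE]; move: al; rewrite lE /= ltnn.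
Qed.

Lemma size_star_part p q lam : size (star_part p q lam) = q.
Proof. by rewrite size_map size_rev size_iota. Qed.

(** A first part equal to q adds 1 to each lambda'_k with k <= q, and p grows by 1 as well, so every
    p - lambda'_k is unchanged. *)
Lemma star_part_cons p q lam :
  star_part p.+1 q (q :: lam) = star_part p q lam.
Proof.
apply/eq_in_map => k; rewrite mem_rev mem_iota /conj_part /= => /andP[_ kq].
by rewrite -ltnS kq add1n subSS.
Qed.

(** No part reaches q + 1, so lambda'_(q+1) = 0, and this column contributes the new leading entry
    p. *)
Lemma star_part_rcons p q lam : all (leq^~ q) lam ->
  star_part p q.+1 lam = p :: star_part p q lam.
Proof.
move=> al; rewrite /star_part -[in LHS](addn1 q) iotaD rev_cat /= add1n.
congr cons; rewrite /conj_part (@eq_in_count _ _ pred0) ?count_pred0 ?subn0//.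
by move=> x xl /=; apply/negbTE; rewrite -leqNgt; exact: (allP al).
Qed.

Section DualCauchy.
Variable F : fieldType.
Implicit Types xs ys zs : seq F.

Lemma nodal_cat xs ys z : nodal (xs ++ ys) z = nodal xs z * nodal ys z.
Proof. exact: big_cat. Qed.

Lemma nodal_rem zs z : uniq zs -> nodal zs z = \prod_(w <- rem z zs) (z - w).
Proof. by move=> uz; rewrite rem_filter// big_filter. Qed.

Lemma prodrN_seq zs (f : F -> F) :
  \prod_(z <- zs) - f z = (-1) ^+ size zs * \prod_(z <- zs) f z.
Proof.
elim: zs => [|z zs IH]; first by rewrite !big_nil mul1r.
by rewrite !big_cons IH exprS; ring.
Qed.

(** Every level of the expansion is a sum [lagr], equal to 1. *)
Lemma sch_nseq0 xs : uniq xs -> sch (nseq (size xs) 0%N) xs = 1.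
Proof.
move: {2}(size xs) (erefl (size xs)) => n; elim: n xs => [|n IH] xs sx ux.
  by rewrite sx.
rewrite sx /= -[RHS](@lagr1 _ xs)//; last by case: (xs) sx.
rewrite /lagr big_seq [RHS]big_seq; apply: eq_bigr => x xx.
have sr : size (rem x xs) = n by rewrite size_rem ?sx.
by rewrite size_nseq -{2}sr IH ?rem_uniq// mulr1 sx.
Qed.

Lemma vol_den_reml xs ys x : x \in xs ->
  vol_den xs ys = \prod_(y <- ys) (x + y) * vol_den (rem x xs) ys.
Proof.
move=> xx; rewrite -vol_den_consl; apply: eq_bigr => y _.
exact/perm_big/perm_to_rem.
Qed.

Lemma vol_den_remr xs ys y : y \in ys ->
  vol_den xs ys = \prod_(x <- xs) (x + y) * vol_den xs (rem y ys).
Proof.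
move=> yy; rewrite -vol_den_consr; exact/perm_big/perm_to_rem.
Qed.

(** The x_i and the - y_k serve together as interpolation nodes; their distinctness also makes every
    x_i + y_k nonzero. *)
Definition generic xs ys := uniq (xs ++ [seq - y | y <- ys]).

Lemma genericP xs ys : generic xs ys ->
  [/\ uniq xs, uniq ys & forall x y, x \in xs -> y \in ys -> x + y != 0].
Proof.
rewrite /generic cat_uniq map_inj_uniq; last exact: oppr_inj.
move=> /and3P[ux /hasPn h uy]; split=> // x y xx yy.
rewrite addr_eq0; apply: contraTneq xx => ->; apply: h.
by rewrite mem_map//; exact: oppr_inj.
Qed.

Lemma generic_sub xs ys xs' ys' : subseq xs' xs -> subseq ys' ys ->
  generic xs ys -> generic xs' ys'.
Proof. by move=> sx sy; apply: subseq_uniq; rewrite cat_subseq// map_subseq. Qed.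

Lemma generic_prodl xs ys x : generic xs ys -> x \in xs ->
  \prod_(y <- ys) (x + y) != 0.
Proof.
move=> /genericP[_ _ h] xx; rewrite prodf_seq_neq0.
by apply/allP => y yy /=; exact: h.
Qed.

Lemma generic_prodr xs ys y : generic xs ys -> y \in ys ->
  \prod_(x <- xs) (x + y) != 0.
Proof.
move=> /genericP[_ _ h] yy; rewrite prodf_seq_neq0.
by apply/allP => x xx /=; exact: h.
Qed.

(** This is [lagr1] at the nodes x_i and - y_k, multiplied by [vol_den]. At the node x, the factors
    x + y of its nodal product cancel the part of [vol_den] that involves x; likewise at - y. *)
Lemma sum_lagr xs ys : generic xs ys -> (0 < size xs + size ys)%N ->
  \sum_(x <- xs) x ^+ (size xs + size ys).-1 / nodal xs x * vol_den (rem x xs) ys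
  + \sum_(y <- ys) y ^+ (size xs + size ys).-1 / nodal ys y * vol_den xs (rem y ys)
  = vol_den xs ys.
Proof.
move=> g sz; have [ux uy xy] := genericP g.
rewrite -[RHS]mulr1 -(lagr1 g); last by rewrite -size_eq0 size_cat size_map -lt0n.
rewrite /lagr big_cat /= size_cat size_map mulrDr !mulr_sumr big_map.
congr (_ + _); rewrite big_seq [RHS]big_seq; apply: eq_bigr; [move=> x xx|move=> y yy].
  rewrite (vol_den_reml ys xx).
  have -> : nodal (xs ++ [seq - y | y <- ys]) x = nodal xs x * \prod_(y <- ys) (x + y).
    rewrite /nodal big_cat /= big_map; congr (_ * _).
    rewrite [LHS]big_seq_cond [RHS]big_seq; apply: eq_big => [y|y _]; last by rewrite opprK.
    case: (boolP (y \in ys)) => //= yy; rewrite eq_sym -subr_eq0 opprK.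
    exact: xy.
  have n1 := generic_prodl g xx; have n2 := nodal_neq0 xs x.
  by field; rewrite n1 n2.
rewrite (vol_den_remr xs yy).
(* With N nodes in all, each of the N - 1 differences at - y is the negative of x + y or of y - y'.
   The resulting sign cancels against that of (- y)^(N-1). *)
have -> : nodal (xs ++ [seq - y | y <- ys]) (- y) =
    (-1) ^+ (size xs + size ys).-1 * (nodal ys y * \prod_(x <- xs) (x + y)).
  have uNy : uniq (map -%R ys) by rewrite map_inj_uniq//; exact: oppr_inj.
  have yNy : - y \in map -%R ys by rewrite map_f.
  have yx : - y \notin xs.
    by apply/negP => /xy/(_ yy); rewrite addNr eqxx.
  rewrite nodal_cat (nodal_rem _ uNy) (nodal_rem _ ux) (nodal_rem _ uy) rem_id//.
  have -> : rem (- y) (map -%R ys) = map -%R (rem y ys).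
    rewrite !rem_filter// filter_map; congr map.
    by apply: eq_filter => w /=; rewrite eqr_opp.
  have -> : (size xs + size ys).-1 = (size xs + size (rem y ys))%N.
    by rewrite size_rem//; case: (ys) yy => //= *; rewrite addnS.
  rewrite addnC exprD big_map mulrACA -!prodrN_seq mulrC; congr (_ * _).
    by apply: eq_bigr => w _; rewrite opprK opprB addrC.
  by apply: eq_bigr => w _; rewrite opprD addrC.
have n1 := generic_prodr g yy; have n2 := nodal_neq0 ys y.
rewrite (exprNn y); have e0 : (-1) ^+ (size xs + size ys).-1 != 0 :> F by rewrite signr_eq0.
move: ((-1) ^+ _ : F) e0 => e e0; by field; rewrite n1 n2 e0.
Qed.

(** Both sides split in two. If the first part of lambda is maximal, expanding the first Schur
    factor produces the x-half of [sum_lagr]. Otherwise the first part of the dual partition is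
    maximal, and expanding the second factor produces the y-half. *)
Lemma dual_cauchy p q xs ys : size xs = p -> size ys = q -> generic xs ys ->
  \sum_(lam <- box p q) sch lam xs * sch (star_part p q lam) ys = vol_den xs ys.
Proof.
elim/box_ind: p / q xs ys => [q|p|p q IHp IHq] xs ys sx sy g.
- have [_ uy _] := genericP g.
  rewrite (size0nil sx) box0 big_seq1 /= mul1r /vol_den.
  rewrite [RHS]big1 => [|y _]; last by rewrite big_nil.
  rewrite -[RHS](sch_nseq0 uy); congr sch; rewrite sy.
  have /all_pred1P : all (pred1 0%N) (star_part 0 q [::]).
    by rewrite all_map; apply/allP => k _ /=; rewrite sub0n.
  by rewrite size_star_part.
- have [ux _ _] := genericP g.
  rewrite (_ : box p.+1 0 = [:: nseq p.+1 0%N])// big_seq1 (size0nil sy).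
  rewrite /vol_den big_nil -{1}sx sch_nseq0//.
  by rewrite mulr1.
- have [ux uy _] := genericP g.
  rewrite boxSS big_cat big_map -sum_lagr ?sx ?sy//.
  congr (_ + _).
    under eq_bigr do rewrite star_part_cons /= mulr_suml.
    rewrite exchange_big /= big_seq [RHS]big_seq; apply: eq_bigr => x xx.
    rewrite -(IHp _ ys) ?size_rem ?sx//; last first.
      by apply: generic_sub g => //; exact: rem_subseq.
    rewrite mulr_sumr big_seq [RHS]big_seq; apply: eq_bigr => l.
    rewrite mem_box => /and3P[/eqP -> _ _].
    by rewrite addSn addnS addnC mulrA.
  under eq_big_seq => l lb.
    move: (lb); rewrite mem_box => /and3P[_ _ al].
    rewrite star_part_rcons//= size_star_part mulr_sumr; over.
  rewrite exchange_big /= big_seq [RHS]big_seq; apply: eq_bigr => y yy.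
  rewrite -(IHq xs) ?size_rem ?sy//; last first.
    by apply: generic_sub g => //; exact: rem_subseq.
  rewrite mulr_sumr; apply: eq_bigr => l _.
  by rewrite addSn addnS mulrCA.
Qed.

(** Divided by [vol_den], the recursion holds node by node: at the node z it is z (x + y) = x (z +
    y) + y (z - x). The node x itself is missing from the sum over [xs], in accordance with the
    factor z - x. *)
Lemma vol_num_lagr xs ys : generic xs ys ->
  vol_num xs ys =
  \sum_(x <- xs) x ^+ (size xs + size ys).-1 / nodal xs x * vol_den (rem x xs) ys.
Proof.
elim/vol_num_ind: xs / ys => [ys|x xs|x xs y ys IH1 IH2] g.
- by rewrite vol_num_nil big_nil.
- have [ux _ _] := genericP g; rewrite vol_num_cons_nil -(lagr1 ux)//.
  by apply: eq_bigr => z _; rewrite addn0 /vol_den big_nil mulr1.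
have g1 : generic (x :: xs) ys by apply: generic_sub g => //; exact: subseq_cons.
have g2 : generic xs (y :: ys) by apply: generic_sub g => //; exact: subseq_cons.
have [/= /andP[xxs ux] _ xy] := genericP g.
rewrite vol_num_cons (IH1 g1) (IH2 g2) /= !addnS.
rewrite !big_cons /= !eqxx vol_den_consr mulrDr mulrDl -addrA; congr (_ + _).
  by rewrite exprS; ring.
rewrite !(mulr_sumr, mulr_suml) -big_split /= big_seq [RHS]big_seq.
apply: eq_bigr => z zz.
have xz : x != z by apply: contraNneq xxs => ->.
have zx0 : z - x != 0 by rewrite subr_eq0 eq_sym.
have nz := nodal_neq0 xs z.
rewrite (negbTE xz) nodal_cons_neq// !vol_den_consl !vol_den_consr big_cons.
rewrite (perm_big _ (perm_to_rem zz)) /= big_cons exprS.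
by field; rewrite zx0 nz.
Qed.

(** Since lambda_1 = q is fixed, the first-row expansion yields the power x^(p+q-1). The other parts
    range over all of B(p-1, q), where the dual Cauchy identity sums them. *)
Theorem schur_sum_vol_num p q xs ys : size xs = p -> size ys = q -> generic xs ys ->
  \sum_(lam <- boxC p q) sch lam xs * sch (star_part p q lam) ys = vol_num xs ys.
Proof.
case: p => [|p] sx sy g; first by rewrite big_nil (size0nil sx) vol_num_nil.
rewrite vol_num_lagr// big_map.
under eq_bigr do rewrite star_part_cons /= mulr_suml.
rewrite exchange_big /= big_seq [RHS]big_seq; apply: eq_bigr => x xx.
rewrite sx sy -(dual_cauchy (p:=p) (q:=q)) ?size_rem ?sx//; last first.
  by apply: generic_sub g => //; exact: rem_subseq.
rewrite mulr_sumr big_seq [RHS]big_seq; apply: eq_bigr => l.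
rewrite mem_box => /and3P[/eqP -> _ _].
by rewrite addSn addnC mulrA.
Qed.

End DualCauchy.

(** * The polynomials S and D *)

Lemma comp_mpoly_mvar (K : idomainType) m n (t : m.-tuple (mpoly n K)) i :
  comp_mpoly t (mvar i) = tnth t i.
Proof. by rewrite /mvar comp_mpolyXU -tnth_nth. Qed.

(** [sch] involves division, hence the fraction field. Distinct entries of [t] keep the Vandermonde
    product nonzero, so it can be cancelled from the equation that characterizes [schur]. *)
Lemma comp_schur (K : idomainType) m n (t : m.-tuple (mpoly n K)) lam :
  size lam = m -> uniq t ->
  tofrac (comp_mpoly t (schur K m lam)) = sch lam [seq tofrac x | x <- t].
Proof.
move=> sl ut; set fs := [seq _ | _ <- _].
have sfs : size fs = m by rewrite size_map size_tuple.
have fsE (i : 'I_m) : fs`_i = tofrac (comp_mpoly t (mvar i)).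
  by rewrite comp_mpoly_mvar (nth_map 0) ?size_tuple// -tnth_nth.
have ufs : uniq fs.
  by rewrite map_inj_uniq// => x y /eqP; rewrite tofrac_eq => /eqP.
have vE : tofrac (comp_mpoly t (vandermonde K m)) = vand fs.
  rewrite (vandE sfs) /vandermonde !rmorph_prod; apply: eq_bigr => i _.
  by rewrite !rmorph_prod; apply: eq_bigr => j _; rewrite !fsE !rmorphB.
have v0 : vand fs != 0.
  rewrite (vandE sfs); apply/prodf_neq0 => i _; apply/prodf_neq0 => j ij.
  by rewrite subr_eq0 nth_uniq ?sfs//; apply: contraTneq ij => ->; rewrite ltnn.
apply: (mulIf v0); rewrite -(det_alternant sl sfs ufs) -vE -!rmorphM schurP.
rewrite /alternant -!det_map_mx; congr (\det _); apply/matrixP => i j.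
by rewrite !mxE !rmorphXn fsE.
Qed.

Lemma frakC_box p q : perm_eq [seq parts lam | lam <- enum (frakC p q)]
  (boxC p q).
Proof.
have pinj : injective (@parts p q).
  by move=> s t /(inj_map val_inj) st; exact: val_inj.
have partsK (l : seq nat) : size l = p -> all (leq^~ q) l ->
    exists lam : p.-tuple 'I_q.+1, parts lam = l.
  move=> sl al; have sl' : size (map (@inord q) l) == p by rewrite size_map sl.
  exists (Tuple sl'); rewrite /parts /= -map_comp -[RHS]map_id.
  by apply/eq_in_map => x xl /=; rewrite inordK// ltnS; exact: (allP al).
apply: uniq_perm.
- by rewrite map_inj_uniq// enum_uniq.
- by case: p {pinj partsK} => // p; rewrite map_inj_uniq ?uniq_box// => x y [].
move=> l; apply/mapP/idP => [[lam]|].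
  rewrite mem_enum !inE => /andP[srt /eqP hd] ->.
  have sz : size (parts lam) = p by rewrite size_map size_tuple.
  have al : all (leq^~ q) (parts lam).
    by apply/allP => _ /mapP[x _ ->] /=; rewrite -ltnS.
  move: sz al srt hd; case: (parts lam) => [//|a s] /=.
  case: p {pinj partsK lam} => // p [sz] /andP[_ al] srt [->].
  by rewrite map_f// mem_box sz eqxx al (path_sorted srt).
case: p pinj partsK => [//|p] pinj partsK /mapP[s].
rewrite mem_box => /and3P[/eqP sz srt al] lE.
have [||lam lamE] := partsK l; rewrite ?lE /= ?sz ?leqnn//.
exists lam; last by rewrite lamE.
by rewrite mem_enum !inE lamE lE /= eqxx andbT path_min_sorted.
Qed.

Section SpolyVolNum.
Variables (K : idomainType) (p q : nat).

Definition xvars : seq (mpoly (p + q) K) := [tuple xvar K q j | j < p].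
Definition yvars : seq (mpoly (p + q) K) := [tuple yvar K p k | k < q].

Lemma DpolyE : Dpoly K p q = vol_den xvars yvars.
Proof.
rewrite /Dpoly /vol_den big_map (_ : tval (ord_tuple q) = enum 'I_q); last first.
  exact: val_ord_tuple.
rewrite big_enum; apply: eq_bigr => k _.
rewrite big_map (_ : tval (ord_tuple p) = enum 'I_p); last exact: val_ord_tuple.
by rewrite big_enum.
Qed.

Lemma mvar_neqN n (i j : 'I_n) : i != j -> mvar i != - mvar j :> mpoly n K.
Proof.
move=> ij; apply/eqP => /(congr1 (mcoeff (mnm1 i))).
rewrite mcoeffN /mvar !mcoeffXU eqxx eq_sym (negbTE ij) oppr0 => /eqP.
by rewrite oner_eq0.
Qed.

Lemma generic_vars : generic [seq tofrac x | x <- xvars] [seq tofrac y | y <- yvars].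
Proof.
rewrite /generic; have -> : [seq - y | y <- [seq tofrac y | y <- yvars]] =
    [seq tofrac y | y <- map -%R yvars].
  by rewrite -!map_comp; apply: eq_map => y /=; rewrite tofracN.
rewrite -map_cat map_inj_uniq; last first.
  by move=> x y /eqP; rewrite tofrac_eq => /eqP.
rewrite cat_uniq map_inj_uniq ?enum_uniq /=; last first.
  by move=> i j /mvar_inj /lshift_inj.
rewrite map_inj_uniq; last exact: oppr_inj.
rewrite map_inj_uniq ?enum_uniq ?andbT; last by move=> i j /mvar_inj /rshift_inj.
apply/hasPn => _ /mapP[_ /mapP[k _ ->] ->]; apply/negP => /mapP[j _ /eqP].
by rewrite eq_sym; apply/negP/mvar_neqN; rewrite eq_lrshift.
Qed.

(** Indeterminates are always generic, so the Lagrange formula applies to them. The resulting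
    identity is between polynomials and may be evaluated anywhere, in particular at repeated
    eigenvalues. *)
Lemma SpolyE : Spoly K p q = vol_num xvars yvars.
Proof.
apply/eqP; rewrite -tofrac_eq; apply/eqP.
have [ux uy _] := genericP generic_vars.
rewrite rmorph_vol_num -(schur_sum_vol_num (p := p) (q := q))//; last first.
- exact: generic_vars.
- by rewrite size_map size_tuple.
- by rewrite size_map size_tuple.
rewrite /Spoly rmorph_sum /=.
transitivity (\sum_(l <- [seq parts lam | lam <- enum (frakC p q)])
   sch l [seq tofrac x | x <- xvars] *
   sch (star_part p q l) [seq tofrac y | y <- yvars]).
  rewrite big_map big_enum; apply: eq_bigr => lam _; rewrite rmorphM /=.
  rewrite !comp_schur ?size_star_part//.
  - exact: map_uniq uy.
  - by rewrite size_map size_tuple.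
  - exact: map_uniq ux.
by rewrite (perm_big _ (frakC_box p q)).
Qed.

End SpolyVolNum.


Section VolNumClosed.
Variables (K : comNzRingType) (n : nat).
Implicit Types xs ys : seq (mpoly n K).

(** The recursion contains no subtraction. With the polynomials over [Num.nat] as [S], this gives
    coefficients in the natural numbers, which the quotient of an alternant does not show. *)
Lemma rpred_vol_num (S : semiringClosed (mpoly n K)) xs ys :
  all [in S] xs -> all [in S] ys -> vol_num xs ys \in S.
Proof.
have pr zs w : all [in S] zs -> w \in S -> \prod_(z <- zs) (z + w) \in S.
  move=> /allP zS wS; rewrite big_seq rpred_prod// => z zz.
  by rewrite rpredD//; exact: zS.
elim/vol_num_ind: xs / ys => [ys|x xs|x xs y ys IH1 IH2].
- by rewrite vol_num_nil rpred0.
- by rewrite vol_num_cons_nil rpred1.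
move=> /= /andP[xS xsS] /andP[yS ysS]; rewrite vol_num_cons.
under [X in _ + _ * X]eq_bigr do rewrite addrC.
by rewrite rpredD// !rpredM ?pr ?IH1 ?IH2//= ?xS ?yS.
Qed.

Lemma dhomog_prod_add xs y : all [in ishomog1 1 mdeg] xs ->
  y \is ishomog1 1 mdeg -> \prod_(x <- xs) (x + y) \is ishomog1 (size xs) mdeg.
Proof.
elim: xs => [|x xs IH] /=; first by rewrite big_nil dhomog1.
move=> /andP[hx hxs] hy; rewrite big_cons -[(size xs).+1]/(1 + size xs)%N.
by rewrite dhomogM ?IH// rpredD.
Qed.

Lemma dhomog_vol_num xs ys :
  all [in ishomog1 1 mdeg] xs -> all [in ishomog1 1 mdeg] ys ->
  vol_num xs ys \is ishomog1 (size xs * size ys) mdeg.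
Proof.
elim/vol_num_ind: xs / ys => [ys|x xs|x xs y ys IH1 IH2].
- by rewrite vol_num_nil rpred0.
- by rewrite vol_num_cons_nil muln0 dhomog1.
move=> /= /andP[hx hxs] /andP[hy hys]; rewrite vol_num_cons.
under [X in _ + _ * X]eq_bigr do rewrite addrC.
apply: rpredD.
  (* The three degrees are those of the factor x, of the smaller numerator and of the product over
     [xs]. *)
  have -> : ((size xs).+1 * (size ys).+1 =
             1 + (size (x :: xs) * size ys) + size xs)%N by rewrite /=; lia.
  by rewrite !dhomogM ?dhomog_prod_add ?IH1//= ?hx.
have -> : ((size xs).+1 * (size ys).+1 =
             1 + (size xs * size (y :: ys)) + size ys)%N by rewrite /=; lia.
by rewrite !dhomogM ?dhomog_prod_add ?IH2//= ?hy.
Qed.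

Lemma rpred_vol_den (S : semiringClosed (mpoly n K)) xs ys :
  all [in S] xs -> all [in S] ys -> vol_den xs ys \in S.
Proof.
move=> /allP xS /allP yS; rewrite /vol_den big_seq rpred_prod// => y yy.
by rewrite big_seq rpred_prod// => x xx; apply: rpredD; [exact: xS|exact: yS].
Qed.

Lemma dhomog_vol_den xs ys :
  all [in ishomog1 1 mdeg] xs -> all [in ishomog1 1 mdeg] ys ->
  vol_den xs ys \is ishomog1 (size xs * size ys) mdeg.
Proof.
move=> hxs; elim: ys => [|y ys IH] /=; first by rewrite /vol_den big_nil muln0 dhomog1.
move=> /andP[hy hys]; rewrite vol_den_consr mulnS dhomogM ?IH//.
exact: dhomog_prod_add.
Qed.

End VolNumClosed.

Section SDproperties.
Variables (K : idomainType) (p q : nat).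

Lemma size_xvars : size (xvars K p q) = p. Proof. exact: size_tuple. Qed.
Lemma size_yvars : size (yvars K p q) = q. Proof. exact: size_tuple. Qed.

Lemma vars_closed (S : pred (mpoly (p + q) K)) : (forall i, mvar i \in S) ->
  all [in S] (xvars K p q) /\ all [in S] (yvars K p q).
Proof.
by move=> h; split; apply/allP => _ /mapP[i _ ->]; exact: h.
Qed.

Lemma dhomog_mvar (i : 'I_(p + q)) : mvar i \is (ishomog1 1 mdeg : qualifier 0 (mpoly _ K)).
Proof. by rewrite /mvar dhomogX; apply/eqP; exact: mdeg1. Qed.

Lemma dhomog_Spoly : Spoly K p q \is ishomog1 (p * q) mdeg.
Proof.
have [hx hy] := vars_closed dhomog_mvar.
by have := dhomog_vol_num hx hy; rewrite -SpolyE size_xvars size_yvars.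
Qed.

Lemma dhomog_Dpoly : Dpoly K p q \is ishomog1 (p * q) mdeg.
Proof.
have [hx hy] := vars_closed dhomog_mvar.
by have := dhomog_vol_den hx hy; rewrite -DpolyE size_xvars size_yvars.
Qed.

Lemma mvar_over (S : semiringClosed K) (i : 'I_(p + q)) :
  mvar i \in @mpolyOver (p + q) K S.
Proof.
by apply/mpolyOverP => m; rewrite /mvar mcoeffX; case: eqP; rewrite ?rpred0 ?rpred1.
Qed.

Lemma Spoly_over (S : semiringClosed K) : Spoly K p q \in @mpolyOver (p + q) K S.
Proof.
have [hx hy] := vars_closed (mvar_over S).
rewrite SpolyE; exact: rpred_vol_num.
Qed.

Lemma Dpoly_over (S : semiringClosed K) : Dpoly K p q \in @mpolyOver (p + q) K S.
Proof.
have [hx hy] := vars_closed (mvar_over S).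
rewrite DpolyE; exact: rpred_vol_den.
Qed.

Definition xvals (v : 'I_(p + q) -> K) := [seq v (lshift q j) | j <- enum 'I_p].
Definition yvals (v : 'I_(p + q) -> K) := [seq v (rshift p k) | k <- enum 'I_q].

Lemma meval_xvars v : map (meval v) (xvars K p q) = xvals v.
Proof.
rewrite -map_comp (_ : tval (ord_tuple p) = enum 'I_p); last exact: val_ord_tuple.
by apply: eq_map => i /=; rewrite mevalXU.
Qed.

Lemma meval_yvars v : map (meval v) (yvars K p q) = yvals v.
Proof.
rewrite -map_comp (_ : tval (ord_tuple q) = enum 'I_q); last exact: val_ord_tuple.
by apply: eq_map => i /=; rewrite mevalXU.
Qed.

Lemma meval_Spoly v : meval v (Spoly K p q) = vol_num (xvals v) (yvals v).
Proof. by rewrite SpolyE rmorph_vol_num meval_xvars meval_yvars. Qed.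

Lemma meval_Dpoly v : meval v (Dpoly K p q) = vol_den (xvals v) (yvals v).
Proof. by rewrite DpolyE rmorph_vol_den meval_xvars meval_yvars. Qed.

End SDproperties.

(** * Scaling of measures *)

Definition image_measure d1 d2 (T1 : measurableType d1) (T2 : measurableType d2)
    (R : realType) (m : {measure set T1 -> \bar R}) (f : T1 -> T2)
    (mf : measurable_fun setT f) : {measure set T2 -> \bar R} :=
  measure_function_pushforward__canonical__measure_function_Measure m mf.

Section rescaling.
Context d (T : measurableType d) (R : realType).
Implicit Types (mu : {measure set T -> \bar R}) (s : T -> T) (k : R).

(** As preimages are measured, [k] is the reciprocal of the factor by which [s] expands volume. *)
Definition rescales (mu : set T -> \bar R) s k :=
  forall A, measurable A -> mu (s @^-1` A) = (k%:E * mu A)%E.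

Lemma rescales_integral mu s k (f : T -> \bar R) : 0 <= k ->
  measurable_fun setT s -> rescales mu s k -> measurable_fun setT f -> (forall x, 0 <= f x)%E ->
  (\int[mu]_x f (s x) = k%:E * \int[mu]_x f x)%E.
Proof.
move=> k0 ms sk mf f0.
rewrite -(ge0_integral_mscale mu measurableT (NngNum k0) mf)//.
rewrite -(@ge0_integral_pushforward _ _ _ _ _ _ ms mu setT f)//.
apply: (eq_measure_integral (mscale (NngNum k0) mu) (m1 := image_measure mu ms)).
by move=> A mA _; exact: sk.
Qed.

End rescaling.

Section rescaling_prod.
Context d1 d2 (T1 : measurableType d1) (T2 : measurableType d2) (R : realType).
Variables (m1 : {sigma_finite_measure set T1 -> \bar R}).
Variables (m2 : {sigma_finite_measure set T2 -> \bar R}).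

Lemma sigma_prod_ysection A : measurable A ->
  sigma_prod m1 m2 A = (\int[m2]_y m1 (ysection A y))%E.
Proof.
move=> mA; have := @product_measure_unique _ _ _ _ _ m1 m2 (m1 \x^ m2)%E.
by apply => // *; exact: product_measure2E.
Qed.

Lemma rescales_prod s1 s2 k1 k2 : 0 <= k1 -> 0 <= k2 ->
  measurable_fun setT s1 -> measurable_fun setT s2 ->
  rescales m1 s1 k1 -> rescales m2 s2 k2 ->
  rescales (sigma_prod m1 m2) (fun z => (s1 z.1, s2 z.2)) (k1 * k2).
Proof.
move=> k10 k20 ms1 ms2 sk1 sk2 A mA.
have mxA := measurable_fun_xsection m2 mA.
transitivity (\int[m1]_x (k2%:E * m2 (xsection A (s1 x))))%E.
  apply: eq_integral => x _ /=; rewrite -sk2; last exact: measurable_xsection.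
  by congr (m2 _); apply/seteqP; split=> y; rewrite /xsection /= !inE.
rewrite ge0_integralZl//; last exact: (measurableT_comp mxA ms1).
rewrite (rescales_integral (mu := m1) (k := k1) (f := m2 \o xsection A) k10 ms1)//.
by rewrite muleA /= EFinM (muleC k1%:E).
Qed.

End rescaling_prod.

Section tuple_rescaling.
Context d (T : measurableType d) (R : realType).
Variable mu : {sigma_finite_measure set T -> \bar R}.

Lemma rescales_tuple n (s : 'I_n -> T -> T) :
  (forall i, measurable_fun setT (s i)) ->
  (forall i, rescales mu (s i) 1) ->
  rescales (tuple_measure mu n) (fun t => [tuple s i (tnth t i) | i < n]) 1.
Proof.
elim: n s => [|n IH] s ms rs A mA.
  rewrite mul1e; congr (tuple_measure _ _ _).
  suff E t : [tuple s i (tnth t i) | i < 0] = t by apply/seteqP; split=> t /=; rewrite E.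
  by apply: eq_from_tnth => -[].
rewrite /= /tcons_measure /pushforward mul1e.
have mA' : measurable (@tcons _ T n @^-1` A).
  by rewrite -[X in measurable X]setTI; exact: measurable_tcons.
have := rescales_prod ler01 ler01 (ms ord0) _ (rs ord0) (IH (fun i => s (lift ord0 i)) _ _) mA'.
rewrite mul1r mul1e => <- //.
  congr (sigma_prod _ _ _); apply/seteqP.
  suff E x : [tuple s i (tnth (tcons x) i) | i < n.+1] =
      tcons (s ord0 x.1, [tuple s (lift ord0 i) (tnth x.2 i) | i < n]).
    by split=> x /=; rewrite E.
  apply: eq_from_tnth => i; rewrite tnth_mktuple.
  by case: (unliftP ord0 i) => [j|] ->; rewrite ?tnthS ?tnth_mktuple.
apply/measurable_fun_tnthP => i.
have := measurableT_comp (ms (lift ord0 i)) (@measurable_tnth _ T n i).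
by apply: eq_measurable_fun => t _ /=; rewrite tnth_mktuple.
Qed.

End tuple_rescaling.

Section lebesgue_rescaling.
Variable R : realType.
Notation mu := (@lebesgue_measure R).

Lemma lebesgue_shift (a : R) : rescales mu (fun x : measurableTypeR R => x + a) 1.
Proof.
move=> A mA; rewrite mul1e.
pose f (x : measurableTypeR R) : measurableTypeR R := x + a.
have ms : measurable_fun setT f.
  exact: measurable_funD.
apply/esym; apply: (lebesgue_measure_unique (mu := image_measure mu ms)) => //.
move=> _ [[b c] _ <-]; transitivity (mu (f @^-1` `]b, c]%classic)); last by [].
have -> : f @^-1` `]b, c]%classic = `]b - a, c - a]%classic.
  by apply/seteqP; split=> x /=; rewrite !in_itv/= ltrBlDr lerBrDr.
rewrite !lebesgue_measure_itv/= !lte_fin ltrD2r; case: ifPn => // _.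
by rewrite -!EFinB; congr (_%:E); ring.
Qed.

Lemma lebesgue_scale (a : {posnum R}) :
  rescales mu (fun x : measurableTypeR R => a%:num * x) a%:num^-1.
Proof.
move=> A mA.
pose f (x : measurableTypeR R) : measurableTypeR R := a%:num * x.
have ms : measurable_fun setT f.
  exact: measurable_funM.
have -> : mu A = mscale (NngNum (ge0 a)) (image_measure mu ms) A.
  apply: lebesgue_measure_unique => // _ [[b c] _ <-].
  transitivity ((a%:num)%:E * mu (f @^-1` `]b, c]%classic))%E; last by [].
  have -> : f @^-1` `]b, c]%classic =
      `]a%:num^-1 * b, a%:num^-1 * c]%classic.
    by apply/seteqP; split=> x /=; rewrite !in_itv/= ltr_pdivrMl// ler_pdivlMl.
  rewrite !lebesgue_measure_itv/= !lte_fin ltr_pM2l//.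
  case: ifPn => // _; last by rewrite mule0.
  by rewrite -!EFinB -EFinM -mulrBr mulVKf.
by rewrite /mscale /= muleA -EFinM mulVf// mul1e.
Qed.

End lebesgue_rescaling.

(** * The Lebesgue measure of the plane *)

Section plane.
Variable R : realType.
Notation mu := (@lebesgue_measure R).
Notation plane := (measurableTypeR R * measurableTypeR R)%type.

Definition leb2 : {sigma_finite_measure set plane -> \bar R} := sigma_prod mu mu.

Definition sq (z : plane) : R := z.1 ^+ 2 + z.2 ^+ 2.

Lemma sq_ge0 z : 0 <= sq z.
Proof. by rewrite addr_ge0// sqr_ge0. Qed.

Lemma measurable_sq : measurable_fun setT (sq : plane -> measurableTypeR R).
Proof.
by apply: measurable_funD; apply: measurable_funX;
  [exact: measurable_fst|exact: measurable_snd].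
Qed.

Lemma leb2_shift (w : plane) : rescales leb2 (fun z => (z.1 + w.1, z.2 + w.2)) 1.
Proof.
have := rescales_prod (m1 := mu) (m2 := mu) (s1 := fun x => x + w.1)
  (s2 := fun x => x + w.2) ler01 ler01.
rewrite mulr1; apply; try exact: lebesgue_shift; exact: measurable_funD.
Qed.

Lemma leb2_scale (a : {posnum R}) :
  rescales leb2 (fun z => (a%:num * z.1, a%:num * z.2)) (a%:num ^- 2).
Proof.
have a0 : 0 <= a%:num^-1 by [].
have := rescales_prod (m1 := mu) (m2 := mu) (s1 := fun x => a%:num * x)
  (s2 := fun x => a%:num * x) a0 a0.
rewrite -invfM -expr2; apply; try exact: lebesgue_scale; exact: measurable_funM.
Qed.

(** This number is pi, but all that matters is that it lies strictly between 0 and infinity. *)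
Definition disc_area : \bar R := leb2 [set z | sq z <= 1].

Lemma measurable_disc r : measurable [set z | sq z <= r].
Proof.
rewrite (_ : [set _ | _] = sq @^-1` `]-oo, r]%classic); last first.
  by apply/seteqP; split=> z /=; rewrite in_itv.
by rewrite -[X in measurable X]setTI; exact: measurable_sq.
Qed.

Lemma leb2_setX (A B : set (measurableTypeR R)) : measurable A -> measurable B ->
  leb2 (A `*` B) = (mu A * mu B)%E.
Proof. by move=> mA mB; exact: product_measure1E. Qed.

Lemma leb2X (a b c e : R) : a <= b -> c <= e ->
  leb2 (`[a, b]%classic `*` `[c, e]%classic) = ((b - a) * (e - c))%:E.
Proof.
move=> ab ce; rewrite leb2_setX//.
rewrite !lebesgue_measure_itv/= !lte_fin EFinM.
by congr (_ * _)%E; case: ltgtP ab ce => //; case: ltgtP => //= *; subst; rewrite ?subrr.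
Qed.

Lemma disc_area_fin : (disc_area < +oo)%E.
Proof.
have : (disc_area <= leb2 (`[(- 1)%R, 1%R]%classic `*` `[(- 1)%R, 1%R]%classic))%E.
  apply: le_measure; rewrite ?inE.
  - exact: measurable_disc.
  - exact: measurableX.
  move=> [x y]; rewrite /sq /= !in_itv /= => h.
  have := sqr_ge0 x; have := sqr_ge0 y => hx hy.
  by split; apply/andP; split; nra.
by move=> /le_lt_trans; apply; rewrite leb2X ?ltry//; lra.
Qed.

Lemma disc_area_gt0 : (0 < disc_area)%E.
Proof.
have : (leb2 (`[0%R, 2^-1%R]%classic `*` `[0%R, 2^-1%R]%classic) <= disc_area)%E.
  apply: le_measure; rewrite ?inE.
  - exact: measurableX.
  - exact: measurable_disc.
  move=> [x y]; rewrite /sq /= !in_itv /= => -[/andP[x0 x1] /andP[y0 y1]].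
  by nra.
have h0 : 0 <= 2^-1 :> R by rewrite invr_ge0.
by apply: lt_le_trans; rewrite (leb2X h0 h0) lte_fin subr0 mulr_gt0// invr_gt0.
Qed.

Lemma disc_area_fin_num : disc_area \is a fin_num.
Proof. by rewrite ge0_fin_numE ?disc_area_fin// ltW// disc_area_gt0. Qed.

Lemma leb2_disc (r : R) : 0 <= r -> leb2 [set z | sq z <= r] = (disc_area * r%:E)%E.
Proof.
rewrite le_eqVlt => /predU1P[<-|r0].
  rewrite mule0 (_ : [set _ | _] = [set 0] `*` [set 0]); last first.
    apply/seteqP; split=> -[x y] /=; rewrite /sq /=; last first.
      by move=> [-> ->]; rewrite expr0n addr0.
    by move=> h; have := sqr_ge0 x; have := sqr_ge0 y => hx hy;
      split; apply/eqP; rewrite -sqrf_eq0; apply/eqP; lra.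
  by rewrite leb2_setX// lebesgue_measure_set1 mul0e.
have s0 : 0 < (Num.sqrt r)^-1 by rewrite invr_gt0 sqrtr_gt0.
have := leb2_scale (PosNum s0) (measurable_disc 1).
rewrite exprVn invrK sqr_sqrtr ?ltW// muleC => <-; congr (leb2 _).
have E (z : plane) : sq ((Num.sqrt r)^-1 * z.1, (Num.sqrt r)^-1 * z.2) = r^-1 * sq z.
  by rewrite /sq !exprMn exprVn sqr_sqrtr ?ltW// mulrDr.
by apply/seteqP; split=> z /=; rewrite E ler_pdivrMl// mulr1.
Qed.

Lemma leb2_sq_itv (a b : R) : a <= b ->
  leb2 (sq @^-1` `]a, b]%classic) = (disc_area * (Num.max b 0 - Num.max a 0)%:E)%E.
Proof.
move=> ab; have F r : leb2 [set z | sq z <= r] = (disc_area * (Num.max r 0)%:E)%E.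
  have [r0|r0] := leP 0 r; first exact: leb2_disc.
  rewrite mule0 (_ : [set _ | _] = set0) ?measure0//; apply/seteqP; split=> z //=.
  by move=> /le_lt_trans/(_ r0); rewrite ltNge sq_ge0.
have -> : sq @^-1` `]a, b]%classic = [set z | sq z <= b] `\` [set z | sq z <= a].
  apply/seteqP; split=> z /=; rewrite in_itv/=.
    by move=> /andP[az zb]; split=> //; apply/negP; rewrite -ltNge.
  by move=> [zb /negP]; rewrite -ltNge => ->.
rewrite measureD; [|exact: measurable_disc|exact: measurable_disc|].
  rewrite setIidr; last by move=> z /= /le_trans; apply.
  by rewrite /= !F -(fineK disc_area_fin_num) -!EFinM -EFinB -mulrBr.
by rewrite /= F -(fineK disc_area_fin_num) -EFinM ltry.
Qed.

(** The area of the disc [sq z <= r] is linear in r, so the image of the plane measure under [sq] is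
    a multiple of Lebesgue measure on the half-line. This takes the place of polar coordinates. *)
Lemma leb2_sq (A : set (measurableTypeR R)) : measurable A -> A `<=` `[0, +oo[%classic ->
  leb2 (sq @^-1` A) = (disc_area * mu A)%E.
Proof.
move=> mA A0; have Dfin := disc_area_fin_num.
have D0 : 0 < fine disc_area by rewrite fine_gt0// disc_area_gt0 disc_area_fin.
have DV : ((fine disc_area)^-1%:E * disc_area = 1)%E.
  by rewrite -[X in (_ * X)%E](fineK Dfin) -EFinM mulVf// gt_eqF.
have k0 : 0 <= (fine disc_area)^-1 by rewrite invr_ge0 ltW.
have mN : measurable (`]-oo, 0%R[%classic : set (measurableTypeR R)) by [].
(* The uniqueness theorem for Lebesgue measure concerns the whole line. The normalized image measure
   is therefore completed by Lebesgue measure on the negative half-line. *)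
pose rho := measure_add (mscale (NngNum k0) (image_measure leb2 measurable_sq)) (mrestr mu mN).
have rhoE B : rho B = ((fine disc_area)^-1%:E * leb2 (sq @^-1` B) + mu (B `&` `]-oo, 0%R[%classic))%E.
  by rewrite /rho /= measure_addE.
have : mu A = rho A.
  apply: (lebesgue_measure_unique (mu := rho)) => // X oX.
  rewrite -[RHS]/(rho X) rhoE; case: oX => [[a b] _ <-] /=.
  have [ba|ab] := leP b a.
    have -> : `]a, b]%classic = set0 :> set (measurableTypeR R).
      by apply: set_itv_ge; rewrite bnd_simp -leNgt.
    by rewrite preimage_set0 set0I !measure0 mule0 adde0.
  rewrite leb2_sq_itv ?ltW// muleA DV mul1e.
  rewrite lebesgue_measure_itv/= lte_fin ab.
  have [b0|b0] := ltP b 0.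
    rewrite max_r ?ltW ?(lt_trans ab)// subrr add0e.
    rewrite setIidl ?lebesgue_measure_itv/= ?lte_fin ?ab//.
    by move=> x /=; rewrite !in_itv/= => /andP[_ /le_lt_trans ->].
  have [a0|a0] := ltP a 0.
    rewrite (_ : _ `&` _ = `]a, 0%R[%classic).
      rewrite lebesgue_measure_itv/= lte_fin a0 -!EFinB -EFinD; congr (_%:E).
      by ring.
    apply/seteqP; split=> x /=; rewrite !in_itv/=; first by move=> [/andP[-> _] ->].
    by move=> /andP[-> x0]; rewrite x0 (le_trans (ltW x0)).
  rewrite (_ : _ `&` _ = set0) ?measure0 ?adde0//.
  apply/seteqP; split=> x //= []; rewrite !in_itv/= => /andP[ax _].
  by rewrite ltNge (le_trans a0 (ltW ax)).
rewrite rhoE (_ : A `&` _ = set0); last first.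
  apply/seteqP; split=> x //= [/A0 /=]; rewrite !in_itv/= andbT => x0.
  by rewrite ltNge x0.
rewrite measure0 adde0 => ->.
by rewrite muleCA muleA DV mul1e.
Qed.

(** For f u = g u * exp(- u) this says that the squared modulus of a Gaussian coordinate is a
    standard exponential variable, up to the total mass [disc_area]. *)
Lemma radial_integral (f : R -> \bar R) :
  measurable_fun setT (f : measurableTypeR R -> \bar R) -> (forall x, 0 <= f x)%E ->
  (\int[leb2]_z f (sq z) = disc_area * \int[mu]_(u in `[0%R, +oo[) f u)%E.
Proof.
move=> mf f0.
have Dfin := disc_area_fin_num.
have D0 : 0 <= fine disc_area by rewrite fine_ge0// ltW// disc_area_gt0.
have mP : measurable (`[0%R, +oo[%classic : set (measurableTypeR R)) by [].
transitivity (\int[image_measure leb2 measurable_sq]_(u in `[0%R, +oo[) f u)%E.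
  rewrite (ge0_integral_pushforward measurable_sq)//; last exact: measurable_funTS.
  rewrite (_ : _ @^-1` _ = setT)//; apply/seteqP; split=> z //= _.
  by rewrite in_itv/= sq_ge0.
rewrite -[X in (X * _)%E](fineK Dfin).
rewrite -(ge0_integral_mscale mu mP (NngNum D0))//; last exact: measurable_funTS.
apply: (eq_measure_integral (mscale (NngNum D0) mu)) => A mA AS.
by rewrite -[LHS]/(leb2 (sq @^-1` A)) leb2_sq// -[in LHS](fineK Dfin).
Qed.

End plane.

(** * Exponential variables *)

Section exponential.
Variable R : realType.
Notation mu := (@lebesgue_measure R).
Local Open Scope ereal_scope.

Lemma integral_expR_tail (r b : R) : (0 < r)%R ->
  \int[mu]_(u in `[b, +oo[) (expR (- r * u))%:E = (expR (- r * b) / r)%:E.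
Proof.
move=> r0; have cexp : continuous (fun z : R^o => expR (- r * z)).
  move=> z; apply: continuous_comp; last exact: continuous_expR.
  by apply: continuousM => //; apply: (@continuousN _ R^o); exact: cst_continuous.
rewrite (@ge0_continuous_FTC2y _ _ (fun x => - (expR (- r * x) / r))%R _ 0%R).
- by rewrite -EFinN opprK add0e.
- by move=> x _; exact: expR_ge0.
- by apply: continuous_subspaceT => x; exact: cexp.
- rewrite [X in _ --> X](_ : _ = - (0 / r))%R; last by rewrite mul0r oppr0.
  apply: cvgN; apply: cvgMl.
  rewrite (_ : (fun x => expR (- r * x)%R) =
               (fun z => expR (- z)) \o (fun z => r * z)%R); last first.
    by apply: eq_fun => x; rewrite mulNr.
  apply: (@cvg_comp _ _ _ _ _ _ (pinfty_nbhs R)); last exact: cvgr_expR.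
  exact: gt0_cvgMry.
- by move=> x _; exact: ex_derive.
- by apply: cvgN; apply: cvgMl; apply/cvg_at_right_filter; exact: cexp.
- move=> z _; rewrite derive1E derive_val.
  by rewrite scaler0 add0r /GRing.scale /= mulr1; field; rewrite gt_eqF.
Qed.

Definition expect (f : R -> \bar R) : \bar R :=
  \int[mu]_(u in `[0%R, +oo[) (f u * (expR (- u))%:E).

Notation mfun f := (measurable_fun setT (f : measurableTypeR R -> \bar R)).

Lemma measurable_expRN : measurable_fun setT (fun u : measurableTypeR R => (expR (- u))%:E).
Proof. by apply/measurable_EFinP; apply: measurableT_comp => //; exact: measurable_expR. Qed.

(** An integral over the whole line against a density is the form to which Tonelli's theorem applies
    directly. *)
Lemma expectT (f : R -> \bar R) :
  expect f = \int[mu]_u (f u * (exponential_pdf 1 u)%:E).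
Proof.
rewrite /expect integral_mkcond; apply: eq_integral => u _.
rewrite patchE mem_setE in_itv/= andbT; case: (leP 0%R u) => u0.
  by rewrite exponential_pdfE// mul1r mulN1r.
by rewrite lt0_exponential_pdf// mule0.
Qed.

Lemma expect_ge0 f : (forall x, 0 <= f x) -> 0 <= expect f.
Proof. by move=> f0; apply: integral_ge0 => u _; rewrite mule_ge0// lee_fin expR_ge0. Qed.

Lemma eq_expect (f g : R -> \bar R) : (forall u, (0 <= u)%R -> f u = g u) -> expect f = expect g.
Proof.
by move=> fg; apply: eq_integral => u; rewrite inE/= in_itv/= andbT => /fg ->.
Qed.

Lemma expectD f g : mfun f -> mfun g -> (forall x, 0 <= f x) -> (forall x, 0 <= g x) ->
  expect (f \+ g) = expect f + expect g.
Proof.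
move=> mf mg f0 g0; rewrite -ge0_integralD//.
- by apply: eq_integral => u _; rewrite /= ge0_muleDl.
- by move=> u _; rewrite mule_ge0// lee_fin expR_ge0.
- by apply: measurable_funTS; apply: emeasurable_funM => //; exact: measurable_expRN.
- by move=> u _; rewrite mule_ge0// lee_fin expR_ge0.
- by apply: measurable_funTS; apply: emeasurable_funM => //; exact: measurable_expRN.
Qed.

Lemma expectZ (k : \bar R) f : mfun f -> (forall x, 0 <= f x) -> 0 <= k ->
  expect (fun u => k * f u) = k * expect f.
Proof.
move=> mf f0 k0; rewrite -ge0_integralZl//.
- by apply: eq_integral => u _; rewrite muleA.
- by apply: measurable_funTS; apply: emeasurable_funM => //; exact: measurable_expRN.
- by move=> u _; rewrite mule_ge0// lee_fin expR_ge0.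
Qed.

Lemma expect_expR (r : R) : (0 <= r)%R ->
  expect (fun u => (expR (- r * u))%:E) = ((1 + r)^-1)%:E.
Proof.
move=> r0; have r1 : (0 < 1 + r)%R by rewrite ltr_pwDl.
have := @integral_expR_tail (1 + r) 0 r1; rewrite mulr0 expR0 div1r => <-.
apply: eq_integral => u _.
by rewrite -EFinM -expRD; congr (expR _)%:E; ring.
Qed.

Lemma expect1 : expect (cst 1) = 1.
Proof.
transitivity (expect (fun u => (expR (- 0 * u))%:E)); last first.
  by rewrite expect_expR// addr0 invr1.
by apply: eq_expect => u _ /=; rewrite oppr0 mul0r expR0.
Qed.

Lemma expect_cst (k : \bar R) : 0 <= k -> expect (cst k) = k.
Proof.
move=> k0; rewrite -[RHS]mule1 -expect1 -expectZ//.
by apply: eq_expect => u _ /=; rewrite mule1.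
Qed.

Lemma measurable_expect d (T : measurableType d) (f : T * measurableTypeR R -> \bar R) :
  measurable_fun setT f -> (forall x, 0 <= f x) ->
  measurable_fun setT (fun x => expect (fun u => f (x, u))).
Proof.
move=> mf f0; under eq_fun do rewrite expectT.
apply: (measurable_fun_fubini_tonelli_F (m2 := mu)
  (fun z : T * measurableTypeR R => f z * (exponential_pdf 1 z.2)%:E)).
  apply: emeasurable_funM => //; apply/measurable_EFinP.
  have mp := measurable_exponential_pdf (1 : R)%R.
  exact: (measurableT_comp mp (@measurable_snd _ _ T (measurableTypeR R))).
by move=> z; rewrite mule_ge0// lee_fin exponential_pdf_ge0.
Qed.

Lemma expect_swap (f : measurableTypeR R * measurableTypeR R -> \bar R) :
  measurable_fun setT f -> (forall x, 0 <= f x) ->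
  expect (fun u => expect (fun v => f (u, v))) = expect (fun v => expect (fun u => f (u, v))).
Proof.
move=> mf f0; have p0 u : 0 <= (exponential_pdf 1 u)%:E :> \bar R.
  by rewrite lee_fin exponential_pdf_ge0.
have mp := measurable_exponential_pdf (1 : R)%R.
pose g (z : measurableTypeR R * measurableTypeR R) :=
  f z * (exponential_pdf 1 z.1)%:E * (exponential_pdf 1 z.2)%:E.
have mg : measurable_fun setT g.
  apply: emeasurable_funM; first apply: emeasurable_funM => //.
  - by apply/measurable_EFinP; exact: (measurableT_comp mp).
  - by apply/measurable_EFinP; exact: (measurableT_comp mp).
have g0 z : 0 <= g z by rewrite /g !mule_ge0.
rewrite !expectT; transitivity (\int[mu]_u \int[mu]_v g (u, v)).
  apply: eq_integral => u _; rewrite expectT.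
  have mfu : measurable_fun setT (fun v : measurableTypeR R => f (u, v) * (exponential_pdf 1 v)%:E).
    apply: emeasurable_funM; last exact/measurable_EFinP.
    exact: measurableT_comp mf (measurable_pair1 _).
  rewrite -(ge0_integralZr mu measurableT mfu _ (p0 u)); last first.
    by move=> v _; rewrite mule_ge0.
  by apply: eq_integral => v _; rewrite /g /= muleAC.
rewrite (fubini_tonelli g mg g0); apply: eq_integral => v _.
rewrite expectT -ge0_integralZr//.
- apply: emeasurable_funM; last exact/measurable_EFinP.
  exact: measurableT_comp mf (measurable_pair2 _).
- by move=> u _; rewrite mule_ge0.
Qed.

Definition halfline : set (measurableTypeR R) := `]-oo, 0%R[.

(** The probability that a_1 E_1 + ... + a_n E_n > t for independent standard exponential variables:
    each integration lowers the threshold by a_i E_i, and what remains of it has to be negative. As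
    the half-line is open, the empty sum has value 0 at t = 0, in agreement with [vol_num]. *)
Fixpoint gauss_prob (d : seq R) (t : R) : \bar R :=
  if d is a :: d' then expect (fun u => gauss_prob d' (t - a * u)%R)
  else (\1_halfline t)%:E.

End exponential.

(** * Distribution of a signed sum of exponential variables *)

Section gauss_prob.
Variable R : realType.
Notation mu := (@lebesgue_measure R).
Notation mfun f := (measurable_fun setT (f : measurableTypeR R -> \bar R)).
Local Open Scope ereal_scope.

(** The endpoint 0 is a null set. It has to be discarded when the threshold is 0, because the strict
    inequality may fail there. *)
Lemma eq_expect_gt0 (f g : R -> \bar R) : mfun f -> mfun g ->
  (forall u, (0 < u)%R -> f u = g u) -> expect f = expect g.
Proof.
move=> mf mg fg; rewrite /expect -!integral_itv_obnd_cbnd.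
- by apply: eq_integral => u; rewrite inE/= in_itv/= andbT => /fg ->.
- by apply: measurable_funTS; apply: emeasurable_funM => //; exact: measurable_expRN.
- by apply: measurable_funTS; apply: emeasurable_funM => //; exact: measurable_expRN.
Qed.

Lemma measurable_affine (a t : R) :
  measurable_fun setT (fun u : measurableTypeR R => (t - a * u)%R : measurableTypeR R).
Proof. by apply: measurable_funB => //; exact: measurable_funM. Qed.

Lemma gauss_prob_ge0 d (t : R) : 0 <= gauss_prob d t.
Proof.
elim: d t => [|a d IH] t /=; first by rewrite lee_fin.
exact: expect_ge0.
Qed.

Lemma measurable_gauss_prob d : mfun (gauss_prob d).
Proof.
elim: d => [|a d IH] /=.
  apply/measurable_EFinP; apply: measurable_indic; exact: measurable_itv.
apply: (measurable_expect (f := fun z : measurableTypeR R * measurableTypeR R =>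
  gauss_prob d (z.1 - a * z.2)%R)) => [|z]; last exact: gauss_prob_ge0.
apply: (measurableT_comp IH); apply: measurable_funB => //.
exact: measurable_funM.
Qed.

Lemma gauss_prob_swap a b d (t : R) : gauss_prob [:: a, b & d] t = gauss_prob [:: b, a & d] t.
Proof.
rewrite /= (expect_swap (f := fun z : measurableTypeR R * measurableTypeR R =>
   gauss_prob d (t - a * z.1 - b * z.2)%R)) => [||z]; last exact: gauss_prob_ge0.
  by apply: eq_expect => u _ /=; apply: eq_expect => v _ /=; rewrite addrAC.
apply: (measurableT_comp (measurable_gauss_prob d)).
by apply: measurable_funB; [apply: measurable_funB => //|]; exact: measurable_funM.
Qed.

(** Tonelli's theorem exchanges neighbours. The symmetry allows a positive and a negative term to be
    brought together, and later absorbs the order in which diagonalization lists the eigenvalues. *)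
Lemma perm_gauss_prob d d' (t : R) : perm_eq d d' -> gauss_prob d t = gauss_prob d' t.
Proof.
have P x s (t' : R) : x \in s -> gauss_prob s t' = gauss_prob (x :: rem x s) t'.
  elim: s t' => [//|y s IH] t'; rewrite inE => /predU1P[<-|xs].
    by rewrite rem_cons eqxx.
  rewrite rem_cons; case: (eqVneq y x) => [->//|_].
  by rewrite gauss_prob_swap; apply: eq_expect => u _; exact: IH.
elim: d d' t => [|a d IH] d' t pd.
  by move/perm_size : pd => /esym/size0nil ->.
have ad' : a \in d' by rewrite -(perm_mem pd) mem_head.
rewrite (P _ _ _ ad') /=; apply: eq_expect => u _; apply: IH.
by rewrite -(perm_cons a) (perm_trans pd)// perm_to_rem.
Qed.

Lemma gauss_prob0 r d (t : R) : gauss_prob (nseq r 0%R ++ d) t = gauss_prob d t.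
Proof.
elim: r => [//|r IH] /=; rewrite -[RHS]expect_cst ?gauss_prob_ge0//.
by apply: eq_expect => u _; rewrite mul0r subr0 IH.
Qed.

Lemma expect_indic (A : set (measurableTypeR R)) (f : R -> R) :
  measurable A -> A `<=` `[0%R, +oo[ ->
  expect (fun u => (\1_A u * f u)%:E) = \int[mu]_(u in A) (f u * expR (- u))%:E.
Proof.
move=> mA A0; rewrite /expect -[in RHS](setIidr A0) integral_mkcondr.
apply: eq_integral => u _; rewrite patchE indicE; case: ifPn => _.
  by rewrite mul1r EFinM.
by rewrite mul0r mul0e.
Qed.

Lemma expect_tail (s r : R) : (0 <= s)%R -> (0 <= r)%R ->
  expect (fun u => (\1_(`[s, +oo[%classic) u * expR (- r * u))%:E) =
  (expR (- (1 + r) * s) / (1 + r))%:E.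
Proof.
move=> s0 r0; rewrite expect_indic//; last first.
  by move=> u /=; rewrite !in_itv/= !andbT; exact: le_trans.
rewrite -integral_expR_tail ?ltr_pwDl//; apply: eq_integral => u _.
by rewrite -expRD; congr (expR _)%:E; ring.
Qed.

Lemma gauss_prob1 (a s : R) : (0 < a)%R ->
  gauss_prob [:: a] s = (expR (- (Num.max s 0 / a)))%:E.
Proof.
move=> a0 /=; have [s0|s0] := leP 0%R s; last first.
  rewrite mul0r oppr0 expR0 -[RHS]expect1; apply: eq_expect => u u0 /=.
  rewrite indicE mem_set// /halfline /= in_itv/=.
  by rewrite ltrBlDr add0r (lt_le_trans s0)// mulr_ge0// ltW.
have sa0 : (0 <= s / a)%R by rewrite divr_ge0// ltW.
transitivity (expect (fun u => (\1_(`]s / a, +oo[%classic) u * 1)%:E)).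
  apply: eq_expect => u _; rewrite mulr1 !indicE; congr (_%:R%:E).
  rewrite /halfline; congr (nat_of_bool _).
  by rewrite !mem_setE !in_itv/= andbT ltrBlDr add0r ltr_pdivrMr// mulrC.
rewrite expect_indic//; last first.
  by move=> u /=; rewrite !in_itv/= !andbT => /ltW; exact: le_trans.
under eq_integral do rewrite mul1r.
rewrite integral_itv_obnd_cbnd//; last first.
  by apply: measurable_funTS; exact: measurable_expRN.
have := @integral_expR_tail _ 1 (s / a)%R ltr01; rewrite mulN1r divr1 => <-.
by apply: eq_integral => u _; rewrite mulN1r.
Qed.

Lemma gauss_probN1 (b t : R) : (0 < b)%R ->
  gauss_prob [:: (- b)%R] t = (1 - expR (Num.min t 0 / b))%:E.
Proof.
move=> b0 /=; have [t0|t0] := leP t 0%R; last first.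
  transitivity (expect (cst (0 : \bar R))); last by rewrite expect_cst// mul0r expR0 subrr.
  apply: eq_expect => u u0 /=.
  rewrite indicE memNset// /halfline /= in_itv/=; apply/negP; rewrite -leNgt.
  by rewrite mulNr opprK addr_ge0 ?mulr_ge0// ltW.
have tb0 : (0 <= - (t / b))%R by rewrite -mulNr divr_ge0 ?oppr_ge0// ltW.
(* For r = 0 the tail is the probability of the complementary event u >= - t / b. *)
have := expect_tail tb0 (lexx 0%R).
rewrite addr0 divr1 mulN1r opprK.
set e2 := expect _ => e2E.
have : gauss_prob [:: (- b)%R] t + e2 = 1.
  rewrite /e2 /= -expectD.
  - rewrite -[RHS]expect1; apply: eq_expect => u u0 /=.
    rewrite !indicE -EFinD oppr0 mul0r expR0 mulr1 /halfline !mem_setE !in_itv/= andbT.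
    have -> : (- (t / b) <= u)%R = (0 <= t + b * u)%R.
      by rewrite -mulNr ler_pdivrMr// -subr_ge0 opprK mulrC addrC.
    by rewrite mulNr opprK; case: ltP; rewrite ?addr0 ?add0r.
  - exact: (measurableT_comp (measurable_gauss_prob [::]) (measurable_affine _ _)).
  - apply/measurable_EFinP; apply: measurable_funM; first exact: measurable_indic.
    by apply: measurableT_comp; [exact: measurable_expR|exact: measurable_funM].
  - by move=> x; rewrite lee_fin.
  - by move=> x; rewrite lee_fin mulr_ge0// expR_ge0.
by rewrite e2E => h; rewrite EFinB -[X in _ = X - _]h addeK.
Qed.

(** Lack of memory, verified on tails: given F = v, the event a E > t + b v has probability exp(-
    max(t + b v, 0) / a), which is then averaged over v. *)
Lemma gauss_prob_pair (a b t : R) : (0 < a)%R -> (0 < b)%R ->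
  gauss_prob [:: a; (- b)%R] t =
  (a / (a + b))%:E * gauss_prob [:: a] t +
  (b / (a + b))%:E * gauss_prob [:: (- b)%R] t.
Proof.
move=> a0 b0; have ab0 : (a + b != 0)%R by rewrite gt_eqF// addr_gt0.
have a0' : (a != 0)%R by rewrite gt_eqF.
have b0' : (b != 0)%R by rewrite gt_eqF.
have ba0 : (0 <= b / a)%R by rewrite divr_ge0 ?ltW.
have ba1 : (1 + b / a != 0)%R by rewrite gt_eqF// ltr_pwDl.
rewrite gauss_prob1// gauss_probN1// gauss_prob_swap.
transitivity (expect (fun v => (expR (- (Num.max (t + b * v) 0 / a)))%:E)).
  by apply: eq_expect => v _; rewrite -gauss_prob1// mulNr opprK.
have [t0|t0] := leP 0%R t.
  rewrite mul0r expR0 subrr mule0 adde0 -EFinM.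
  transitivity (expect (fun v => (expR (- (t / a)))%:E * (expR (- (b / a) * v))%:E)).
    apply: eq_expect => v v0; rewrite max_l ?addr_ge0 ?mulr_ge0// ?ltW//.
    by rewrite -EFinM -expRD; congr (expR _)%:E; field.
  have mE : mfun (fun v => (expR (- (b / a) * v))%:E).
    apply/measurable_EFinP; apply: measurableT_comp; first exact: measurable_expR.
    exact: measurable_funM.
  have e0 (x : R) : 0 <= (expR x)%:E :> \bar R by rewrite lee_fin expR_ge0.
  rewrite (expectZ mE)//.
  rewrite expect_expR// -EFinM; congr (_%:E); field.
  by rewrite ab0 a0'.
(* For v < s the threshold t + b v is negative and the event is certain; from s on, an exponential
   tail remains. *)
pose s := (- (t / b))%R; have s0 : (0 <= s)%R by rewrite /s -mulNr divr_ge0 ?oppr_ge0// ltW.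
have mtail : mfun (fun v => (\1_(`[s, +oo[%classic) v * expR (- (b / a) * v))%:E).
  apply/measurable_EFinP; apply: measurable_funM; first exact: measurable_indic.
  by apply: measurableT_comp; [exact: measurable_expR|exact: measurable_funM].
have tail_ge0 v : 0 <= (\1_(`[s, +oo[%classic) v * expR (- (b / a) * v))%:E :> \bar R.
  by rewrite lee_fin mulr_ge0// expR_ge0.
transitivity (gauss_prob [:: (- b)%R] t + expect (fun v => (expR (- (t / a)))%:E *
   (\1_(`[s, +oo[%classic) v * expR (- (b / a) * v))%:E)).
  rewrite /= -expectD.
  - apply: eq_expect => v v0 /=.
    rewrite !indicE /halfline !mem_setE !in_itv/= andbT.
    have -> : (s <= v)%R = (0 <= t + b * v)%R.
      by rewrite /s -mulNr ler_pdivrMr// -subr_ge0 opprK mulrC addrC.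
    rewrite mulNr opprK; case: ltP => _; first by rewrite mul0r oppr0 expR0 mul0r mule0 adde0.
    by rewrite add0e mul1r -EFinM -expRD; congr (expR _)%:E; field.
  - exact: (measurableT_comp (measurable_gauss_prob [::]) (measurable_affine _ _)).
  - by apply: emeasurable_funM.
  - by move=> x; rewrite lee_fin.
  - by move=> x; rewrite mule_ge0// lee_fin expR_ge0.
have e0 (x : R) : 0 <= (expR x)%:E :> \bar R by rewrite lee_fin expR_ge0.
rewrite (expectZ mtail)// expect_tail// gauss_probN1// min_l ?ltW//.
rewrite mul0r oppr0 expR0 -!EFinM -!EFinD; congr (_%:E).
have -> : (expR (- (t / a)) * (expR (- (1 + b / a) * s) / (1 + b / a)) =
   expR (t / b) / (1 + b / a))%R.
  by rewrite mulrA -expRD /s; congr (expR _ / _)%R; field; rewrite ?a0' ?b0'.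
by field; rewrite ?ab0 ?a0'.
Qed.

Lemma gauss_prob_cat_pair d (a b t : R) : (0 < a)%R -> (0 < b)%R ->
  gauss_prob (d ++ [:: a; (- b)%R]) t =
  (a / (a + b))%:E * gauss_prob (d ++ [:: a]) t +
  (b / (a + b))%:E * gauss_prob (d ++ [:: (- b)%R]) t.
Proof.
move=> a0 b0; elim: d t => [|x d IH] t; first exact: gauss_prob_pair.
have m e : mfun (fun u => gauss_prob e (t - x * u)%R).
  exact: (measurableT_comp (measurable_gauss_prob e) (measurable_affine _ _)).
have k1 : 0 <= (a / (a + b))%:E :> \bar R.
  by rewrite lee_fin divr_ge0 ?addr_ge0 ?ltW.
have k2 : 0 <= (b / (a + b))%:E :> \bar R.
  by rewrite lee_fin divr_ge0 ?addr_ge0 ?ltW.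
rewrite !cat_cons /= -!expectZ//; try by move=> ?; exact: gauss_prob_ge0.
rewrite -expectD.
- by apply: eq_expect => u _; exact: IH.
- exact: measurable_funeM.
- exact: measurable_funeM.
- by move=> u; rewrite mule_ge0 ?gauss_prob_ge0.
- by move=> u; rewrite mule_ge0 ?gauss_prob_ge0.
Qed.

Lemma gauss_prob_pos (d : seq R) (t : R) : all (fun a => 0 < a)%R d -> (t < 0)%R ->
  gauss_prob d t = 1.
Proof.
elim: d t => [|a d IH] t /=.
  by move=> _ t0; rewrite indicE mem_set// /halfline /= in_itv/=.
move=> /andP[a0 d0] t0; rewrite -[RHS]expect1; apply: eq_expect => u u0 /=.
by rewrite IH// ltrBlDr add0r (lt_le_trans t0)// mulr_ge0// ltW.
Qed.

Lemma gauss_prob_pos0 a (d : seq R) : (0 < a)%R -> all (fun a => 0 < a)%R d ->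
  gauss_prob (a :: d) 0 = 1.
Proof.
move=> a0 d0; rewrite -[RHS]expect1 /=; apply: eq_expect_gt0.
- exact: (measurableT_comp (measurable_gauss_prob d) (measurable_affine _ _)).
- exact: measurable_cst.
by move=> u u0; rewrite gauss_prob_pos// sub0r oppr_lt0 mulr_gt0.
Qed.

Lemma gauss_prob_neg (d : seq R) (t : R) : all (fun a => 0 < a)%R d -> (0 <= t)%R ->
  gauss_prob (map -%R d) t = 0.
Proof.
elim: d t => [|a d IH] t /=.
  move=> _ t0; rewrite indicE memNset// /halfline /= in_itv/=.
  by apply/negP; rewrite -leNgt.
move=> /andP[a0 d0] t0; transitivity (expect (cst (0 : \bar R))); last exact: expect_cst.
apply: eq_expect => u u0 /=.
by rewrite IH// mulNr opprK addr_ge0// mulr_ge0// ltW.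
Qed.

Lemma gauss_prob_vol r (xs ys : seq R) :
  all (fun a => 0 < a)%R xs -> all (fun a => 0 < a)%R ys ->
  gauss_prob (nseq r 0%R ++ xs ++ map -%R ys) 0 = (vol_num xs ys / vol_den xs ys)%:E.
Proof.
rewrite gauss_prob0; elim/vol_num_ind: xs / ys => [ys|x xs|x xs y ys IH1 IH2].
- by move=> _ y0; rewrite vol_num_nil mul0r gauss_prob_neg.
- move=> /= /andP[x0 xs0] _; rewrite /vol_den big_nil divr1 cats0.
  exact: gauss_prob_pos0.
move=> xxs yys.
have /andP[x0 xs0] : (0 < x)%R && all (fun a => 0 < a)%R xs by [].
have /andP[y0 ys0] : (0 < y)%R && all (fun a => 0 < a)%R ys by [].
have IH1' := IH1 xxs ys0.
have IH2' := IH2 xs0 yys.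
have den0 (us vs : seq R) : all (fun a => 0 < a)%R us -> all (fun a => 0 < a)%R vs ->
    vol_den us vs != 0%R.
  move=> /allP u0 /allP v0; rewrite prodf_seq_neq0; apply/allP => v vv /=.
  rewrite prodf_seq_neq0; apply/allP => u uu /=.
  by rewrite gt_eqF// addr_gt0 ?(u0 _ uu) ?(v0 _ vv).
(* The pair x, - y is moved to the end, where it can be replaced by one of its members. *)
transitivity (gauss_prob ((xs ++ map -%R ys) ++ [:: x; (- y)%R]) 0).
  apply: perm_gauss_prob.
  rewrite perm_sym perm_catC /= perm_cons.
  by have := perm_catCA [:: - y]%R xs (map -%R ys) => /= ->.
rewrite gauss_prob_cat_pair//.
rewrite (@perm_gauss_prob _ ((x :: xs) ++ map -%R ys)); last by rewrite perm_catC.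
rewrite IH1' (@perm_gauss_prob _ (xs ++ map -%R (y :: ys))); last first.
  by rewrite -catA perm_cat2l /= perm_catC.
rewrite IH2' -!EFinM -EFinD; congr (_%:E).
rewrite vol_num_cons !vol_den_consr !vol_den_consl big_cons.
have xy0 : (x + y != 0)%R by rewrite gt_eqF// addr_gt0.
have d1 := den0 _ _ xs0 ys0.
have p1 : (\prod_(z <- xs) (z + y) != 0)%R.
  by rewrite prodf_seq_neq0; apply/allP => u uu /=; rewrite gt_eqF// addr_gt0// (allP xs0 _ uu).
have p2 : (\prod_(z <- ys) (x + z) != 0)%R.
  by rewrite prodf_seq_neq0; apply/allP => u uu /=; rewrite gt_eqF// addr_gt0// (allP ys0 _ uu).
by field; rewrite xy0 d1 p1 p2.
Qed.

End gauss_prob.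

(** * Similarities of C^n *)

Section similarity.
Context d (T : measurableType d) (R : realType).
Variable mu : {sigma_finite_measure set T -> \bar R}.
Variables (add : T -> T -> T) (opp g : T -> T).
Hypothesis madd : measurable_fun setT (fun p : T * T => add p.1 p.2).
Hypothesis mopp : measurable_fun setT opp.
Hypothesis mg : measurable_fun setT g.
Hypothesis addC : forall x y, add x y = add y x.
Hypothesis addK : forall x y, add (add x y) (opp y) = x.
Hypothesis addNK : forall x y, add y (opp (add x y)) = opp x.
Hypothesis shift : forall w, rescales mu (add^~ w) 1.
Hypothesis gadd : forall x y, g (add x y) = add (g x) (g y).
Hypothesis gsurj : forall y, exists x, g x = y.

Let msub d' (T' : measurableType d') (h : T' -> T) (A : set T) :
  measurable_fun setT h -> measurable A -> measurable (h @^-1` A).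
Proof. by move=> mh mA; rewrite -[X in measurable X]setTI; exact: mh. Qed.

Let mgsnd : measurable_fun setT (fun p : T * T => g p.1).
Proof. exact: (measurableT_comp mg). Qed.

Let shift1 w A : measurable A -> mu (add^~ w @^-1` A) = mu A.
Proof. by move=> mA; rewrite shift// mul1e. Qed.

Let prod_cyl (S : set (T * T)) (A : set T) c : (0 <= c)%E -> measurable S -> measurable A ->
  (forall y, mu (ysection S y) = ((\1_A y)%:E * c)%E) -> sigma_prod mu mu S = (mu A * c)%E.
Proof.
move=> c0 mS mA h; rewrite sigma_prod_ysection//.
under eq_integral do rewrite h.
rewrite ge0_integralZr//; first by rewrite integral_indic// setIT.
by apply/measurable_EFinP; exact: measurable_indic.
Qed.

(* Fubini on {(x, y) | y \in B, y + g x \in A}, which the shear (x, y) |-> (x, y + g x)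
   maps onto {(x, y) | y \in A, y - g x \in B}. *)
Lemma similarity_exchange A B : measurable A -> measurable B ->
  (mu B * mu (g @^-1` A) = mu A * mu (g @^-1` (opp @^-1` B)))%E.
Proof.
move=> mA mB.
pose S := [set p : T * T | B p.2 /\ A (add p.2 (g p.1))].
pose S' := [set p : T * T | A p.2 /\ B (add p.2 (opp (g p.1)))].
have mS : measurable S.
  apply: measurableI; first exact: (@msub _ _ snd).
  apply: (@msub _ _ (fun p => add p.2 (g p.1))) => //.
  exact: (measurableT_comp madd (measurable_fun_pair measurable_snd mgsnd)).
have mS' : measurable S'.
  apply: measurableI; first exact: (@msub _ _ snd).
  apply: (@msub _ _ (fun p => add p.2 (opp (g p.1)))) => //.
  apply: (measurableT_comp madd (measurable_fun_pair measurable_snd _)).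
  exact: (measurableT_comp mopp mgsnd).
rewrite -(@prod_cyl S)//; last first.
  move=> y; rewrite indicE; have [yB|yB] := boolP (y \in B); last first.
    rewrite mul0e (_ : ysection S y = set0) ?measure0//; apply/seteqP; split=> x //=.
    by rewrite /ysection /= inE /S /= => -[/mem_set]; rewrite (negbTE yB).
  have [w wy] := gsurj y; rewrite mul1e -(@shift1 w (g @^-1` A)); last exact: (@msub _ _ g).
  congr (mu _); apply/seteqP; move: yB; rewrite inE => wB.
  split=> x; rewrite /ysection /= inE /S /= gadd wy (addC (g x)); first by case.
  by move=> h; split.
rewrite -(@prod_cyl S' A)//; first last.
- move=> y; rewrite indicE; have [yA|yA] := boolP (y \in A); last first.
    rewrite mul0e (_ : ysection S' y = set0) ?measure0//; apply/seteqP; split=> x //=.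
    by rewrite /ysection /= inE /S' /= => -[/mem_set]; rewrite (negbTE yA).
  have [w wy] := gsurj y; rewrite mul1e -(@shift1 w (ysection S' y)); last first.
    exact: measurable_ysection.
  congr (mu _); apply/seteqP; move: yA; rewrite inE => yA.
  split=> x; rewrite /ysection /= inE /S' /= gadd wy addNK; first by case.
  by move=> h; split.
rewrite /= /sigma_prod; apply: eq_integral => x _ /=.
rewrite -(@shift1 (g x) (xsection S' x)); last exact: measurable_xsection.
congr (mu _); apply/seteqP; split=> y; rewrite /xsection /= !inE /S /S' /= addK => -[].
  by split.
by split.
Qed.

(** For a symmetric [B] of positive finite measure, [mu B] cancels from the exchange identity, so
    the behaviour of [g] on [B] decides its behaviour on all measurable sets. This is the argument
    for uniqueness of Haar measure, and it makes a change-of-variables formula for linear maps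
    unnecessary. *)
Lemma similarity_rescales (B : set T) (k : R) : measurable B ->
  (0 < mu B)%E -> (mu B < +oo)%E -> opp @^-1` B = B ->
  mu (g @^-1` B) = (k%:E * mu B)%E -> rescales mu g k.
Proof.
move=> mB B0 Boo oB gB A mA; have := similarity_exchange mA mB.
have Bfin : mu B \is a fin_num by rewrite ge0_fin_numE// ltW.
rewrite oB gB muleA (muleC (mu A)) (muleC _ (mu B)) => h; apply/eqP.
by rewrite eq_le; apply/andP; split; rewrite -(lee_pmul2l Bfin B0) h.
Qed.

End similarity.

(** * Lebesgue measure on C^n and its test sets *)

Section tuple_lebesgue.
Context (R : realType).
Notation plane := (measurableTypeR R * measurableTypeR R)%type.

Lemma integral_tcons n (f : Cspace R n.+1 -> \bar R) :
  measurable_fun setT f -> (forall z, 0 <= f z)%E ->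
  (\int[lebesgueC R n.+1]_z f z =
   \int[leb2 R]_z \int[lebesgueC R n]_w f (tcons (z, w)))%E.
Proof.
move=> mf f0.
pose mu : {sigma_finite_measure set (plane * Cspace R n)%type -> \bar R} :=
  sigma_prod (leb2 R) (lebesgueC R n).
transitivity (\int[mu]_p f (tcons p))%E.
  exact: (ge0_integral_pushforward (@measurable_tcons _ _ n) mu measurableT mf).
apply: (fubini_tonelli1 (m1 := leb2 R) (m2 := lebesgueC R n) (f \o @tcons _ _ n)) => //.
  exact: (measurableT_comp mf (@measurable_tcons _ _ n)).
by move=> z; exact: f0.
Qed.

Lemma measurable_tuple_pair d (T : measurableType d) n (f : T -> Cspace R n) :
  (forall i, measurable_fun setT (fun x => (tnth (f x) i).1)) ->
  (forall i, measurable_fun setT (fun x => (tnth (f x) i).2)) ->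
  measurable_fun setT f.
Proof.
move=> m1 m2; apply/measurable_fun_tnthP => i.
have := measurable_fun_pair (m1 i) (m2 i).
by apply: eq_measurable_fun => x _ /=; rewrite -surjective_pairing.
Qed.

Lemma measurable_tnth1 n i : measurable_fun setT (fun x : Cspace R n => (tnth x i).1).
Proof. exact: (measurableT_comp measurable_fst (measurable_tnth i)). Qed.

Lemma measurable_tnth2 n i : measurable_fun setT (fun x : Cspace R n => (tnth x i).2).
Proof. exact: (measurableT_comp measurable_snd (measurable_tnth i)). Qed.

Definition tadd n (x y : Cspace R n) : Cspace R n :=
  [tuple ((tnth x i).1 + (tnth y i).1, (tnth x i).2 + (tnth y i).2) | i < n].
Definition topp n (x : Cspace R n) : Cspace R n :=
  [tuple (- (tnth x i).1, - (tnth x i).2) | i < n].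

Lemma eq_Cspace n (x y : Cspace R n) : (forall i, (tnth x i).1 = (tnth y i).1) ->
  (forall i, (tnth x i).2 = (tnth y i).2) -> x = y.
Proof.
move=> h1 h2; apply: eq_from_tnth => i; have := h1 i; have := h2 i.
by case: (tnth x i) (tnth y i) => ? ? [? ?] /= -> ->.
Qed.

Lemma measurable_tadd n :
  measurable_fun setT (fun p : (Cspace R n * Cspace R n)%type => tadd p.1 p.2).
Proof.
apply: measurable_tuple_pair => i; under eq_fun do rewrite tnth_mktuple /=.
- apply: measurable_funD.
    exact: (measurableT_comp (measurable_tnth1 i)).
  exact: (measurableT_comp (measurable_tnth1 i)).
- apply: measurable_funD.
    exact: (measurableT_comp (measurable_tnth2 i)).
  exact: (measurableT_comp (measurable_tnth2 i)).
Qed.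

Lemma measurable_topp n : measurable_fun setT (@topp n).
Proof.
apply: measurable_tuple_pair => i; under eq_fun do rewrite tnth_mktuple /=.
- apply: measurableT_comp => //; exact: measurable_tnth1.
- apply: measurableT_comp => //; exact: measurable_tnth2.
Qed.

Lemma rescales_tadd n (w : Cspace R n) : rescales (lebesgueC R n) (fun x => tadd x w) 1.
Proof.
apply: (rescales_tuple (mu := leb2 R)
  (s := fun i (z : plane) => (z.1 + (tnth w i).1, z.2 + (tnth w i).2) : plane)) => i.
  apply: measurable_fun_pair.
    by apply: measurable_funD => //; exact: measurable_fst.
  by apply: measurable_funD => //; exact: measurable_snd.
exact: leb2_shift.
Qed.

Lemma lebesgueC_similarity n (g : Cspace R n -> Cspace R n) (B : set (Cspace R n)) (k : R) :
  measurable_fun setT g -> (forall x y, g (tadd x y) = tadd (g x) (g y)) ->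
  (forall y, exists x, g x = y) ->
  measurable B -> (0 < lebesgueC R n B)%E -> (lebesgueC R n B < +oo)%E ->
  @topp n @^-1` B = B -> lebesgueC R n (g @^-1` B) = (k%:E * lebesgueC R n B)%E ->
  rescales (lebesgueC R n) g k.
Proof.
move=> mg gadd gsurj mB B0 Boo oB gB.
apply: (similarity_rescales (add := @tadd n) (opp := @topp n) _ _ _ _ _ _ _ _ _ mB) => //.
- exact: measurable_tadd.
- exact: measurable_topp.
- by move=> x y; apply: eq_Cspace => i; rewrite !tnth_mktuple /= addrC.
- by move=> x y; apply: eq_Cspace => i; rewrite !tnth_mktuple /= addrK.
- by move=> x y; apply: eq_Cspace => i; rewrite !tnth_mktuple /= opprD addrC subrK.
- exact: rescales_tadd.
Qed.

Definition polydisc n (r : R) : set (Cspace R n) := [set z | forall i, sq (tnth z i) <= r].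

Lemma measurable_polydisc n r : measurable (@polydisc n r).
Proof.
have -> : @polydisc n r = \bigcap_(i in [set: 'I_n]) ((@tnth n plane)^~ i @^-1` [set z | sq z <= r]).
  by apply/seteqP; split=> t /= H i => [_|]; exact: H.
apply: fin_bigcap_measurable => // i _; rewrite -[X in measurable X]setTI.
by apply: measurable_tnth => //; exact: measurable_disc.
Qed.

Lemma lebesgueC_polydisc n r : 0 <= r ->
  lebesgueC R n (@polydisc n r) = ((fine (disc_area R) * r) ^+ n)%:E.
Proof.
move=> r0; rewrite [LHS](tuple_measure_box (leb2 R) (A := fun=> [set z | sq z <= r])).
  under eq_bigr do rewrite leb2_disc// -(fineK (disc_area_fin_num R)) -EFinM.
  by rewrite prodEFin prodr_const card_ord.
by move=> _; exact: measurable_disc.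
Qed.

Lemma disc_area_fine_gt0 : 0 < fine (disc_area R).
Proof. by rewrite fine_gt0// disc_area_gt0 disc_area_fin. Qed.

Lemma measurable_normsq n : measurable_fun setT (fun z : Cspace R n => normsq z : measurableTypeR R).
Proof.
apply: measurable_sum => i; apply: measurable_funD; apply: measurable_funX.
  exact: measurable_tnth1.
exact: measurable_tnth2.
Qed.

(** The test set for unitary maps, which preserve it. Its measure is not computed, only bounded by
    means of polydiscs. *)
Definition cball n : set (Cspace R n) := [set z | normsq z <= 1].

Lemma measurable_cball n : measurable (@cball n).
Proof.
rewrite (_ : @cball n = (fun z => normsq z) @^-1` `]-oo, 1]%classic); last first.
  by apply/seteqP; split=> z /=; rewrite in_itv.
by rewrite -[X in measurable X]setTI; exact: measurable_normsq.
Qed.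

Lemma lebesgueC_cball_fin n : (lebesgueC R n (@cball n) < +oo)%E.
Proof.
have : (lebesgueC R n (@cball n) <= lebesgueC R n (@polydisc n 1))%E.
  apply: le_measure; rewrite ?inE; [exact: measurable_cball|exact: measurable_polydisc|].
  move=> z zB i; apply: le_trans zB; rewrite /normsq (bigD1 i)//= lerDl.
  by apply: sumr_ge0 => j _; rewrite addr_ge0// sqr_ge0.
by move=> /le_lt_trans; apply; rewrite lebesgueC_polydisc// ltry.
Qed.

Lemma lebesgueC_cball_gt0 n : (0 < lebesgueC R n (@cball n))%E.
Proof.
(* The n squared moduli are at most 1/(n+1) each, so their sum is at most 1; n + 1 instead of n
   covers n = 0. *)
have : (lebesgueC R n (@polydisc n n.+1%:R^-1) <= lebesgueC R n (@cball n))%E.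
  apply: le_measure; rewrite ?inE; [exact: measurable_polydisc|exact: measurable_cball|].
  move=> z zB; rewrite /cball /normsq /=.
  apply: (@le_trans _ _ (\sum_(i < n) n.+1%:R^-1)); first by apply: ler_sum => i _; exact: zB.
  rewrite sumr_const card_ord -[X in X *+ _]mul1r -mulrnAl ler_pdivrMr ?ltr0n//.
  by rewrite mul1r ler_nat.
apply: lt_le_trans; rewrite lebesgueC_polydisc// lte_fin exprn_gt0//.
by rewrite mulr_gt0// disc_area_fine_gt0.
Qed.

End tuple_lebesgue.

(** * Complex linear maps and the Gaussian measure *)

Section complex_linear.
Local Open Scope sesquilinear_scope.
Variable R : realType.
Notation C := R[i].
Notation plane := (measurableTypeR R * measurableTypeR R)%type.

Definition vecC n (z : Cspace R n) : 'cV[C]_n := \col_i complex_of (tnth z i).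
Definition unvecC n (v : 'cV[C]_n) : Cspace R n :=
  [tuple (complex.Re (v i 0), complex.Im (v i 0)) | i < n].
Definition linC n (M : 'M[C]_n) (z : Cspace R n) : Cspace R n := unvecC (M *m vecC z).

Lemma vecCK n : cancel (@vecC n) (@unvecC n).
Proof. by move=> z; apply: eq_Cspace => i; rewrite tnth_mktuple mxE. Qed.

Lemma unvecCK n : cancel (@unvecC n) (@vecC n).
Proof.
move=> v; apply/matrixP => i j; rewrite ord1 mxE tnth_mktuple /complex_of /=.
by case: (v i 0).
Qed.

Lemma vecC_linC n (M : 'M[C]_n) z : vecC (linC M z) = M *m vecC z.
Proof. exact: unvecCK. Qed.

Lemma vecC_tadd n (x y : Cspace R n) : vecC (tadd x y) = vecC x + vecC y.
Proof. by apply/matrixP => i j; rewrite !mxE tnth_mktuple. Qed.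

Lemma linC_tadd n (M : 'M[C]_n) x y : linC M (tadd x y) = tadd (linC M x) (linC M y).
Proof.
by apply: (can_inj (@vecCK n)); rewrite vecC_tadd !vecC_linC vecC_tadd mulmxDr.
Qed.

Lemma linC_surj n (M : 'M[C]_n) y : M \in unitmx -> exists x, linC M x = y.
Proof.
move=> uM; exists (unvecC (invmx M *m vecC y)).
by apply: (can_inj (@vecCK n)); rewrite vecC_linC unvecCK mulKVmx.
Qed.

Lemma measurable_linC n (M : 'M[C]_n) : measurable_fun setT (linC M).
Proof.
have ReD : {morph (@complex.Re R) : x y / x + y} by move=> [? ?] [? ?].
have ImD : {morph (@complex.Im R) : x y / x + y} by move=> [? ?] [? ?].
have Re0 : complex.Re (0 : C) = 0 by [].
have Im0 : complex.Im (0 : C) = 0 by [].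
apply: measurable_tuple_pair => i.
- rewrite (_ : (fun x => _) = (fun x : Cspace R n => \sum_(j < n)
      (complex.Re (M i j) * (tnth x j).1 - complex.Im (M i j) * (tnth x j).2))); last first.
    apply/funext => x; rewrite tnth_mktuple /= mxE (big_morph _ ReD Re0).
    by apply: eq_bigr => j _; rewrite mxE; case: (M i j).
  apply: measurable_sum => j; apply: measurable_funB; apply: measurable_funM => //.
    exact: measurable_tnth1.
  exact: measurable_tnth2.
- rewrite (_ : (fun x => _) = (fun x : Cspace R n => \sum_(j < n)
      (complex.Re (M i j) * (tnth x j).2 + complex.Im (M i j) * (tnth x j).1))); last first.
    apply/funext => x; rewrite tnth_mktuple /= mxE (big_morph _ ImD Im0).
    by apply: eq_bigr => j _; rewrite mxE; case: (M i j).
  apply: measurable_sum => j; apply: measurable_funD; apply: measurable_funM => //.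
    exact: measurable_tnth2.
  exact: measurable_tnth1.
Qed.

Lemma sq_complex (z : plane) : ((sq z)%:C)%C = complex_of z * (complex_of z)^*.
Proof. by rewrite -normCK -add_Re2_Im2. Qed.

Lemma normsq_complex n (z : Cspace R n) :
  ((normsq z)%:C)%C = \sum_i vecC z i 0 * (vecC z i 0)^*.
Proof.
by rewrite /normsq rmorph_sum /=; apply: eq_bigr => i _; rewrite mxE -sq_complex.
Qed.

Lemma mulC_col n (u v : 'cV[C]_n) : (v^t* *m u) 0 0 = \sum_i u i 0 * (v i 0)^*.
Proof. by rewrite mxE; apply: eq_bigr => i _; rewrite !mxE mulrC. Qed.

Lemma normsq_linC n (U : 'M[C]_n) z : U \is unitarymx -> normsq (linC U z) = normsq z.
Proof.
move=> uU; apply: complexI; rewrite !normsq_complex vecC_linC -!mulC_col.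
by rewrite trmx_mul map_mxM -mulmxA -invmx_unitary// mulKmx// unitarymx_unit.
Qed.

Lemma rescales_unitary n (U : 'M[C]_n) : U \is unitarymx ->
  rescales (lebesgueC R n) (linC U) 1.
Proof.
move=> uU; apply: (@lebesgueC_similarity _ _ _ (@cball R n)).
- exact: measurable_linC.
- exact: linC_tadd.
- by move=> y; apply: linC_surj; exact: unitarymx_unit.
- exact: measurable_cball.
- exact: lebesgueC_cball_gt0.
- exact: lebesgueC_cball_fin.
- apply/seteqP; suff E (z : Cspace R n) : normsq (topp z) = normsq z by split=> z /=; rewrite /cball /= E.
  rewrite /normsq.
  by apply: eq_bigr => i _; rewrite tnth_mktuple /= !sqrrN.
- rewrite mul1e; congr (lebesgueC _ _ _); apply/seteqP.
  by split=> z /=; rewrite /cball /= normsq_linC.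
Qed.

Definition dil n (t : plane) : Cspace R n -> Cspace R n := linC (complex_of t)%:M.

Lemma sq_dil n t (z : Cspace R n) i : sq (tnth (dil t z) i) = sq t * sq (tnth z i).
Proof.
apply: complexI; rewrite rmorphM /= !sq_complex.
have -> : complex_of (tnth (dil t z) i) = complex_of t * complex_of (tnth z i).
  have := congr1 (fun v : 'cV[C]_n => v i 0) (vecC_linC (complex_of t)%:M z).
  by rewrite mul_scalar_mx !mxE.
by rewrite rmorphM /=; ring.
Qed.

Lemma normsq_dil n t (z : Cspace R n) : normsq (dil t z) = sq t * normsq z.
Proof. by rewrite /normsq mulr_sumr; apply: eq_bigr => i _; exact: sq_dil. Qed.

Lemma sq_gt0 (t : plane) : t != 0 -> 0 < sq t.
Proof.
move=> t0; rewrite lt_neqAle sq_ge0 andbT eq_sym; apply: contra t0; case: t => a b.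
by rewrite /sq /= paddr_eq0 ?sqr_ge0// !sqrf_eq0 => /andP[/eqP -> /eqP ->].
Qed.

(** The test set is a polydisc: multiplication by t scales every squared modulus by [sq t], so the
    preimage is again a polydisc, with a known measure. The exponent is n rather than 2n because
    [sq t] is already |t|^2. *)
Lemma rescales_dil n (t : plane) : t != 0 -> rescales (lebesgueC R n) (@dil n t) (sq t ^- n).
Proof.
move=> t0.
have sqt := sq_gt0 t0.
have Ct0 : complex_of t != 0.
  rewrite -normr_eq0 -sqrf_eq0 -add_Re2_Im2 /= -/(sq t).
  by apply: contraTneq sqt => /complexI ->; rewrite ltxx.
apply: (@lebesgueC_similarity _ _ _ (@polydisc R n 1)).
- exact: measurable_linC.
- exact: linC_tadd.
- move=> y; apply: linC_surj.
  by rewrite unitmxE det_scalar unitfE expf_neq0.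
- exact: measurable_polydisc.
- by rewrite lebesgueC_polydisc// lte_fin exprn_gt0// mulr1 disc_area_fine_gt0.
- by rewrite lebesgueC_polydisc// ltry.
- apply/seteqP; suff E z i : sq (tnth (@topp R n z) i) = sq (tnth z i).
    by split=> z h i; have := h i; rewrite /= E.
  by rewrite tnth_mktuple /sq /= !sqrrN.
- have -> : @dil n t @^-1` polydisc 1 = polydisc (sq t)^-1.
    apply/seteqP; split=> z h i; have := h i; rewrite sq_dil.
      by rewrite -ler_pdivlMl// mulr1.
    by rewrite -ler_pdivlMl// mulr1.
  rewrite !lebesgueC_polydisc//; last by rewrite invr_ge0 ltW.
  by rewrite -EFinM mulr1 exprMn exprVn mulrC.
Qed.

Definition gauss_weight n (z : Cspace R n) : R := expR (- normsq z).

Lemma measurable_gauss_weight n : measurable_fun setT (@gauss_weight n).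
Proof.
apply: measurableT_comp; first exact: measurable_expR.
by apply: measurableT_comp => //; exact: measurable_normsq.
Qed.

Lemma normsq_tcons n (t : plane) (z : Cspace R n) :
  normsq (tcons (t, z)) = sq t + normsq z.
Proof.
rewrite /normsq big_ord_recl; congr (_ + _).
by apply: eq_bigr => i _; rewrite !tnthS.
Qed.

Local Open Scope ereal_scope.

(** Left unnormalized: the total mass is the n-th power of [disc_area]. *)
Definition gauss_measure n (A : set (Cspace R n)) : \bar R :=
  \int[lebesgueC R n]_z (\1_A z * gauss_weight z)%:E.

Lemma measurable_gauss_indic n (A : set (Cspace R n)) : measurable A ->
  measurable_fun setT (fun z : Cspace R n => (\1_A z * gauss_weight z)%:E).
Proof.
move=> mA; apply/measurable_EFinP; apply: measurable_funM; first exact: measurable_indic.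
exact: measurable_gauss_weight.
Qed.

Lemma gauss_indic_ge0 n (A : set (Cspace R n)) z : 0 <= (\1_A z * gauss_weight z)%:E.
Proof. by rewrite lee_fin mulr_ge0// expR_ge0. Qed.

Lemma gauss_measure_unitary n (U : 'M[C]_n) (A : set (Cspace R n)) :
  U \is unitarymx -> measurable A -> gauss_measure (linC U @^-1` A) = gauss_measure A.
Proof.
move=> uU mA.
have mf := measurable_gauss_indic mA.
rewrite -[RHS]mul1e -(rescales_integral ler01 (measurable_linC U) (rescales_unitary uU) mf).
  by apply: eq_integral => z _; rewrite /gauss_weight normsq_linC.
exact: gauss_indic_ge0.
Qed.

Definition diag_form n (d : seq R) (z : Cspace R n) : R :=
  (\sum_(i < n) d`_i * sq (tnth z i))%R.

Lemma measurable_diag_form n d : measurable_fun setT (diag_form d : Cspace R n -> measurableTypeR R).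
Proof.
apply: measurable_sum => i; apply: measurable_funM => //.
by apply: measurableT_comp; [exact: measurable_sq|exact: measurable_tnth].
Qed.

Lemma measurable_halfspace n d (t : R) :
  measurable [set z : Cspace R n | (t < diag_form d z)%R].
Proof.
rewrite (_ : [set _ | _] = diag_form d @^-1` `]t, +oo[%classic); last first.
  by apply/seteqP; split=> z /=; rewrite in_itv/= andbT.
by rewrite -[X in measurable X]setTI; exact: measurable_diag_form.
Qed.

Lemma diag_form_tcons n a d t (z : Cspace R n) :
  diag_form (a :: d) (tcons (t, z)) = (a * sq t + diag_form d z)%R.
Proof.
rewrite /diag_form big_ord_recl; congr (_ + _)%R.
by apply: eq_bigr => i _; rewrite !tnthS.
Qed.

(** The weight factors over the coordinates, and the form depends only on their squared moduli.
    Integrating out one coordinate by [radial_integral] yields one factor [disc_area] and one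
    exponential variable. *)
Lemma gauss_measure_halfspace n (d : seq R) (t : R) : size d = n ->
  gauss_measure [set z : Cspace R n | (t < diag_form d z)%R] =
  ((fine (disc_area R)) ^+ n)%:E * gauss_prob d t.
Proof.
elim: n d t => [|n IH] [|a d]// t.
  move=> _; rewrite expr0 mul1e /gauss_measure /=.
  have mI := measurable_gauss_indic (@measurable_halfspace 0 [::] t).
  rewrite (integral_dirac _ measurableT mI).
  rewrite /gauss_weight /normsq big_ord0 oppr0 expR0 mulr1 !indicE.
  rewrite diracT mul1e; congr (nat_of_bool _)%:R%:E.
  by apply/idP/idP; rewrite !inE /halfline /= in_itv/= /diag_form big_ord0.
move=> [sd]; have mI := measurable_gauss_indic (@measurable_halfspace n.+1 (a :: d) t).
rewrite /gauss_measure (integral_tcons mI); last exact: gauss_indic_ge0.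
have D0 := disc_area_fine_gt0 R.
have Dn0 : 0 <= ((fine (disc_area R)) ^+ n)%:E :> \bar R by rewrite lee_fin exprn_ge0// ltW.
have mG : measurable_fun setT (fun u : measurableTypeR R => gauss_prob d (t - a * u)%R * (expR (- u))%:E).
  apply: emeasurable_funM; last exact: measurable_expRN.
  exact: (measurableT_comp (measurable_gauss_prob d) (measurable_affine _ _)).
have G0 u : 0 <= gauss_prob d (t - a * u)%R * (expR (- u))%:E.
  by rewrite mule_ge0 ?gauss_prob_ge0// lee_fin expR_ge0.
transitivity (\int[leb2 R]_z (((fine (disc_area R)) ^+ n)%:E *
   (gauss_prob d (t - a * sq z)%R * (expR (- sq z))%:E))).
  apply: eq_integral => z _; rewrite muleA -IH//.
  have mI' := measurable_gauss_indic (@measurable_halfspace n d (t - a * sq z)%R).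
  have e0 : 0 <= (expR (- sq z))%:E :> \bar R by rewrite lee_fin expR_ge0.
  rewrite -(ge0_integralZr _ measurableT mI' _ e0); last by move=> w _; exact: gauss_indic_ge0.
  apply: eq_integral => w _; rewrite -EFinM /gauss_weight normsq_tcons opprD expRD.
  rewrite (mulrC (expR (- sq z))) mulrA; congr (_ * _ * _)%:E.
  rewrite !indicE; congr (_%:R); congr (nat_of_bool _).
  apply/idP/idP; rewrite !inE /= diag_form_tcons ltrBlDl//.
rewrite ge0_integralZl//; last exact: (measurableT_comp mG (@measurable_sq R)).
rewrite (radial_integral mG G0) -/(expect _) exprSr EFinM fineK ?disc_area_fin_num//.
by rewrite muleA.
Qed.

End complex_linear.

(** * Gaussian measure of a complex cone *)

Section fibration.
Variables (R : realType) (n : nat).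
Notation plane := (measurableTypeR R * measurableTypeR R)%type.
Local Open Scope ereal_scope.

Definition unit_plane : plane := (1%R, 0%R).

Definition kappa : \bar R := \int[leb2 R]_t (sq t ^+ n * expR (- sq t))%:E.

Lemma kappa_ge0 : 0 <= kappa.
Proof.
apply: integral_ge0 => t _.
by rewrite lee_fin mulr_ge0 ?expR_ge0// exprn_ge0// sq_ge0.
Qed.

Lemma measurable_kappa_integrand (a : R) :
  measurable_fun setT (fun t : plane => (sq t ^+ n * expR (- (a * sq t)))%:E).
Proof.
apply/measurable_EFinP; apply: measurable_funM.
  by apply: measurable_funX; exact: measurable_sq.
apply: measurableT_comp; first exact: measurable_expR.
apply: measurableT_comp => //; apply: measurable_funM => //; exact: measurable_sq.
Qed.

(** The substitution t -> sqrt a * t gives n factors 1/a from [sq t ^+ n] and one from the area. For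
    a = 1 + |z|^2 this is the Fubini-Study density. *)
Lemma integral_kappa (a : R) : (0 < a)%R ->
  \int[leb2 R]_t (sq t ^+ n * expR (- (a * sq t)))%:E = ((a ^+ n.+1)^-1)%:E * kappa.
Proof.
move=> a0; have s0 : (0 < Num.sqrt a)%R by rewrite sqrtr_gt0.
have mk := measurable_kappa_integrand 1.
have k0 (t : plane) : 0 <= (sq t ^+ n * expR (- (1 * sq t)))%:E.
  by rewrite lee_fin mulr_ge0 ?expR_ge0// exprn_ge0// sq_ge0.
have kE : kappa = \int[leb2 R]_t (sq t ^+ n * expR (- (1 * sq t)))%:E.
  by apply: eq_integral => t _; rewrite mul1r.
have ms : measurable_fun setT (fun z : plane => (Num.sqrt a * z.1, Num.sqrt a * z.2)%R : plane).
  by apply: measurable_fun_pair; apply: measurable_funM.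
have a2 : (0 <= Num.sqrt a ^- 2)%R by rewrite invr_ge0 exprn_ge0// ltW.
have h := rescales_integral a2 ms (leb2_scale (PosNum s0)) mk k0.
rewrite -kE /= sqr_sqrtr ?ltW// in h.
have sqE (t : plane) : sq ((Num.sqrt a * t.1)%R, (Num.sqrt a * t.2)%R) = (a * sq t)%R.
  by rewrite /sq /= !exprMn sqr_sqrtr ?ltW// mulrDr.
rewrite exprSr invfM EFinM -muleA -h.
have ma : measurable_fun setT (fun t : plane => (sq (Num.sqrt a * t.1, Num.sqrt a * t.2) ^+ n *
    expR (- (1 * sq (Num.sqrt a * t.1, Num.sqrt a * t.2))))%:E)%R.
  exact: (measurableT_comp mk ms).
have an0 : 0 <= ((a ^+ n)^-1)%:E by rewrite lee_fin invr_ge0 exprn_ge0// ltW.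
rewrite -(ge0_integralZl _ measurableT ma)//.
apply: eq_integral => t _; rewrite -EFinM sqE mul1r exprMn; congr (_%:E).
by rewrite -mulrA mulKf// expf_neq0// gt_eqF.
Qed.

Lemma leb2_origin : leb2 R [set (0%R : plane)] = 0.
Proof.
rewrite (_ : [set _] = [set 0%R] `*` [set 0%R]).
  by rewrite leb2_setX// lebesgue_measure_set1 mul0e.
by apply/seteqP; split=> -[x y] /= [-> ->].
Qed.

Variable A : set (Cspace R n.+1).
Hypothesis mA : measurable A.
Hypothesis cone : forall (t : plane) z, t != 0%R -> A (tcons (t, dil t z)) <-> A (tcons (unit_plane, z)).

Let U := [set z | A (tcons (unit_plane, z))].

Let mtcons t : measurable_fun setT (fun z : Cspace R n => tcons (t, z)).
Proof. exact: (measurableT_comp (@measurable_tcons _ _ n) (measurable_pair1 t)). Qed.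

Let mU : measurable U.
Proof.
rewrite (_ : U = (fun z => tcons (unit_plane, z)) @^-1` A)//.
by rewrite -[X in measurable X]setTI; exact: mtcons.
Qed.

(** The integrand in the coordinates (t, t z) of C^(n+1): [sq t ^+ n] is the real Jacobian of z -> t
    z, and the exponent is - |t|^2 - |t z|^2. *)
Let W (p : (plane * Cspace R n)%type) : \bar R :=
  (\1_U p.2 * (sq p.1 ^+ n * expR (- ((1 + normsq p.2) * sq p.1))))%:E.

Let mW : measurable_fun setT W.
Proof.
have m1 : measurable_fun setT (fun p : (plane * Cspace R n)%type => sq p.1 : measurableTypeR R).
  exact: (measurableT_comp (@measurable_sq R)).
have m2 : measurable_fun setT (fun p : (plane * Cspace R n)%type => normsq p.2 : measurableTypeR R).
  exact: (measurableT_comp (@measurable_normsq R n)).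
apply/measurable_EFinP; apply: measurable_funM.
  exact: (measurableT_comp (measurable_indic mU)).
apply: measurable_funM; first exact: measurable_funX.
apply: measurableT_comp; first exact: measurable_expR.
by apply: measurableT_comp => //; apply: measurable_funM => //; exact: measurable_funD.
Qed.

Let W0 p : 0 <= W p.
Proof.
by rewrite lee_fin mulr_ge0// mulr_ge0 ?expR_ge0// exprn_ge0// sq_ge0.
Qed.

Let normsq1_gt0 (z : Cspace R n) : (0 < 1 + normsq z)%R.
Proof. by rewrite ltr_pwDl// sumr_ge0// => i _; exact: sq_ge0. Qed.

Let inner (t : plane) : t != 0%R ->
  \int[lebesgueC R n]_z (\1_A (tcons (t, z)) * gauss_weight (tcons (t, z)))%:E =
  \int[lebesgueC R n]_z W (t, z).
Proof.
move=> t0; have sqt := sq_gt0 t0.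
pose f (z : Cspace R n) := (\1_A (tcons (t, z)) * gauss_weight (tcons (t, z)))%:E.
have mf : measurable_fun setT f := measurableT_comp (measurable_gauss_indic mA) (@mtcons t).
have f0 z : 0 <= f z := gauss_indic_ge0 A _.
have md : measurable_fun setT (@dil R n t) by exact: measurable_linC.
have k0 : (0 <= sq t ^- n)%R by rewrite invr_ge0 exprn_ge0// ltW.
have h := rescales_integral k0 md (rescales_dil t0) mf f0.
have E : ((sq t ^+ n)%:E * \int[lebesgueC R n]_z f (dil t z) = \int[lebesgueC R n]_z f z).
  by rewrite h muleA -EFinM mulfV ?mul1e// expf_neq0// gt_eqF.
rewrite -[LHS]E -ge0_integralZl//; last 2 first.
- exact: (measurableT_comp mf md).
- by rewrite lee_fin exprn_ge0// ltW.
apply: eq_integral => z _; rewrite /f /W -EFinM /gauss_weight normsq_tcons normsq_dil.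
congr (_%:E); rewrite mulrCA; congr (_ * (_ * expR _))%R; last by ring.
rewrite !indicE; congr (nat_of_bool _)%:R.
by apply/idP/idP; rewrite !inE => /(cone z t0).
Qed.

(** Every complex line off the hyperplane t = 0 meets the affine chart in one point (1, z). By the
    cone hypothesis the indicator depends on z alone, so the integral over t can be carried out for
    each z by [integral_kappa]. *)
Lemma gauss_measure_cone :
  gauss_measure A = kappa * \int[lebesgueC R n]_(z in U) (((1 + normsq z) ^+ n.+1)^-1)%:E.
Proof.
have mI := measurable_gauss_indic mA.
rewrite /gauss_measure (integral_tcons mI); last exact: gauss_indic_ge0.
have mT : measurable_fun setT (fun p : (plane * Cspace R n)%type =>
    (\1_A (tcons p) * gauss_weight (tcons p))%:E).
  exact: (measurableT_comp mI (@measurable_tcons _ _ n)).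
have T0 p : 0 <= (\1_A (tcons p) * gauss_weight (tcons p))%:E := gauss_indic_ge0 A (tcons p).
transitivity (\int[leb2 R]_t \int[lebesgueC R n]_z W (t, z)).
  (* The substitution z -> t z degenerates only at t = 0, a null set. *)
  apply: ge0_ae_eq_integral => //.
  - exact: (measurable_fun_fubini_tonelli_F (m2 := lebesgueC R n) _ mT T0).
  - exact: (measurable_fun_fubini_tonelli_F (m2 := lebesgueC R n) W mW W0).
  - by move=> t _; apply: integral_ge0 => z _; exact: gauss_indic_ge0.
  - by move=> t _; apply: integral_ge0.
  exists [set (0%R : plane)]; split.
  + rewrite (_ : [set _] = [set 0%R] `*` [set 0%R]); first exact: measurableX.
    by apply/seteqP; split=> -[x y] /= [-> ->].
  + exact: leb2_origin.
  move=> t /= /not_implyP[_ h]; apply: contrapT => /eqP t0; apply: h.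
  exact: inner.
rewrite (fubini_tonelli (m1 := leb2 R) (m2 := lebesgueC R n) W mW W0).
have mU1 : measurable_fun U (fun z : Cspace R n => (((1 + normsq z) ^+ n.+1)^-1)%:E).
  apply: measurable_funTS; apply/measurable_EFinP.
  (* Writing the inverse as exp(- ln) reduces its measurability to that of [expR] and [ln]. *)
  rewrite (_ : (fun z => _) = (fun z : Cspace R n => expR (- ln ((1 + normsq z) ^+ n.+1)%R))); last first.
    by apply/funext => z; rewrite expRN lnK// posrE exprn_gt0.
  apply: measurableT_comp; first exact: measurable_expR.
  apply: measurableT_comp => //; apply: measurableT_comp; first exact: measurable_ln.
  by apply: measurable_funX; apply: measurable_funD => //; exact: measurable_normsq.
rewrite muleC -(ge0_integralZr _ mU mU1 _ kappa_ge0); last first.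
  by move=> z _; rewrite lee_fin invr_ge0 exprn_ge0// ltW.
rewrite [RHS]integral_mkcond; apply: eq_integral => z _; rewrite patchE.
rewrite /W /= indicE; case: ifPn => zU; last first.
  by rewrite integral0_eq// => t _; rewrite mul0r.
under eq_integral do rewrite mul1r.
exact: integral_kappa.
Qed.

End fibration.

(** * Reduction to the diagonal case *)

Lemma char_poly_similar (F : fieldType) m (P M : 'M[F]_m) : P \in unitmx ->
  char_poly (invmx P *m M *m P) = char_poly M.
Proof.
move=> uP; pose f := map_mx (@polyC F).
have PP : f m m (invmx P) *m f m m P = 1%:M by rewrite -map_mxM mulVmx// map_mx1.
rewrite /char_poly.
have -> : char_poly_mx (invmx P *m M *m P) = f m m (invmx P) *m char_poly_mx M *m f m m P.
  rewrite /char_poly_mx mulmxBr mulmxBl !map_mxM; congr (_ - _).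
  by rewrite scalar_mxC -mulmxA PP mulmx1.
by rewrite !det_mulmx mulrAC -det_mulmx PP det1 mul1r.
Qed.

Section projective.
Variables (R : realType) (n : nat).
Notation C := R[i].
Notation plane := (measurableTypeR R * measurableTypeR R)%type.
Local Open Scope sesquilinear_scope.

Lemma herm_mul (u v : 'cV[C]_n.+1) : herm u v = (v^t* *m u) 0 0.
Proof. by rewrite mulC_col. Qed.

Lemma herm_scale (A : 'M[C]_n.+1) (c : C) (v : 'cV[C]_n.+1) :
  herm (A *m (c *: v)) (c *: v) = c * c^* * herm (A *m v) v.
Proof.
rewrite -scalemxAr /herm mulr_sumr; apply: eq_bigr => j _.
by rewrite !mxE rmorphM /=; ring.
Qed.

Lemma sigma_preimage_Omega (A : 'M[C]_n.+1) (z : Cspace R n) :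
  Omega A (sigma z) <-> 0 < herm (A *m sigma_vec z) (sigma_vec z).
Proof.
split=> [[w hw /clsP[c /= zE]]|h]; last by exists (exist (fun v : 'cV[C]_n.+1 => v != 0) _ (sigma_vec_neq0 z)).
rewrite zE herm_scale mulr_gt0// lt_neqAle mul_conjC_ge0 andbT eq_sym mul_conjC_eq0.
by apply: contraNneq (sigma_vec_neq0 z) => c0; rewrite zE c0 scale0r.
Qed.

(** [sigma] puts the coordinate 1 last, whereas [tcons] puts it first. The permutation that moves it
    is unitary and can be absorbed into the diagonalizing matrix. *)
Definition rot_mx : 'M[C]_n.+1 := perm_mx (lift_perm ord_max ord0 1%g).

Lemma unitary_perm_mx m (s : 'S_m) : (perm_mx s : 'M[C]_m) \is unitarymx.
Proof.
by apply/unitarymxP; rewrite tr_perm_mx map_perm_mx -perm_mxM mulgV perm_mx1.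
Qed.

Lemma sigma_vecE (z : Cspace R n) :
  sigma_vec z = rot_mx *m vecC (tcons (unit_plane R, z)).
Proof.
rewrite /rot_mx -row_permE; apply/matrixP => i j; rewrite !mxE.
case: (unliftP ord_max i) => [k|] ->.
  by rewrite lift_perm_lift perm1 tnthS.
by rewrite lift_perm_id.
Qed.

Lemma dil_tcons (t : plane) (z : Cspace R n) :
  dil t (tcons (unit_plane R, z)) = tcons (t, dil t z).
Proof.
apply: (can_inj (@vecCK R n.+1)); apply/matrixP => i j.
rewrite [in LHS]vecC_linC mul_scalar_mx !mxE.
case: (unliftP ord0 i) => [k|] ->.
  rewrite !tnthS.
  have := congr1 (fun v : 'cV[C]_n => v k 0) (vecC_linC (complex_of t)%:M z).
  by rewrite mul_scalar_mx !mxE.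
by rewrite -[RHS]mulr1.
Qed.

Lemma diag_form_dil m d (t : plane) (z : Cspace R m) :
  diag_form d (dil t z) = sq t * diag_form d z.
Proof.
by rewrite /diag_form mulr_sumr; apply: eq_bigr => i _; rewrite sq_dil mulrCA.
Qed.

Lemma linC_dil m (V : 'M[C]_m) (t : plane) z : linC V (dil t z) = dil t (linC V z).
Proof.
apply: (can_inj (@vecCK R m)); rewrite !vecC_linC !mul_scalar_mx.
by rewrite -scalemxAr.
Qed.

Lemma herm_diag_form (P V : 'M[C]_n.+1) (d : seq R) z :
  P \is unitarymx -> V = P *m rot_mx ->
  herm (invmx P *m diag_mx (\row_i (d`_i)%:C%C) *m P *m sigma_vec z) (sigma_vec z) =
  (diag_form d (linC V (tcons (unit_plane R, z))))%:C%C.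
Proof.
move=> uP VE; set w := tcons _; set v := sigma_vec z.
have Pv : P *m v = vecC (linC V w) by rewrite vecC_linC VE -mulmxA -sigma_vecE.
rewrite herm_mul -!mulmxA Pv invmx_unitary// (mulmxA (v ^t* )).
have -> : v^t* *m P^t* = (vecC (linC V w))^t* by rewrite -Pv trmx_mul map_mxM.
rewrite mulC_col /diag_form rmorph_sum; apply: eq_bigr => i _.
by rewrite rmorphM /= sq_complex mul_diag_mx !mxE mulrA.
Qed.

Local Open Scope ereal_scope.

Lemma gauss_measureT m :
  gauss_measure [set: Cspace R m] = ((fine (disc_area R)) ^+ m)%:E.
Proof.
(* The whole space is the set where the zero form exceeds -1. *)
have := @gauss_measure_halfspace R m (nseq m 0%R) (-1)%R (size_nseq m 0%R).
rewrite -{2}(cats0 (nseq m 0%R)) gauss_prob0 /= indicE mem_set; last first.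
  by rewrite /halfline /= in_itv/= ltrN10.
rewrite mule1 => <-; congr gauss_measure; apply/seteqP; split=> z //= _.
rewrite /diag_form big1 ?ltrN10// => i _.
by rewrite nth_nseq; case: ifP => _; rewrite mul0r.
Qed.

(** The Gaussian measure of one cone is computed twice: through its lines, which gives the
    projective volume, and through [V], which turns it into a diagonal half-space. *)
Lemma VolFS_diag (V : 'M[C]_n.+1) (d : seq R) (O : set (CP R n)) :
  V \is unitarymx -> size d = n.+1 ->
  (forall z, O (sigma z) <-> (0 < diag_form d (linC V (tcons (unit_plane R, z))))%R) ->
  kappa R n * VolFS O = ((fine (disc_area R)) ^+ n.+1)%:E * gauss_prob d 0.
Proof.
move=> uV sd OE; rewrite -(gauss_measure_halfspace 0 sd) -(gauss_measure_unitary uV).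
  rewrite gauss_measure_cone.
  - congr (_ * _); rewrite /VolFS; congr (integral _ _ _).
    by apply/seteqP; split=> z /OE.
  - rewrite -[X in measurable X]setTI; apply: measurable_linC => //.
    exact: measurable_halfspace.
  - move=> t z t0 /=; rewrite -dil_tcons linC_dil diag_form_dil.
    by rewrite pmulr_rgt0// sq_gt0.
exact: measurable_halfspace.
Qed.

Lemma VolFS_setT : kappa R n * VolFS [set: CP R n] = ((fine (disc_area R)) ^+ n.+1)%:E.
Proof.
by rewrite -gauss_measureT gauss_measure_cone//; congr (_ * _); congr (integral _ _ _).
Qed.

(** The product in [VolFS_setT] is positive and finite. This excludes the value 0 here and the value
    +oo in [kappa_fin_num], where the product would be 0 or +oo, without evaluating the integral. *)
Lemma kappa_gt0 : 0 < kappa R n.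
Proof.
rewrite lt_neqAle kappa_ge0 andbT; apply/eqP => k0.
have := VolFS_setT; rewrite -k0 mul0e => -[] /eqP.
by rewrite eq_sym gt_eqF// exprn_gt0// disc_area_fine_gt0.
Qed.

Lemma kappa_fin_num : kappa R n \is a fin_num.
Proof.
rewrite ge0_fin_numE ?kappa_ge0// ltey; apply/eqP => koo.
have V0 : 0 <= VolFS [set: CP R n].
  apply: integral_ge0 => z _; rewrite lee_fin invr_ge0 exprn_ge0// addr_ge0//.
  by apply: sumr_ge0 => i _; exact: sq_ge0.
have := VolFS_setT; rewrite koo; move: V0; rewrite le_eqVlt => /predU1P[<-|V0].
  rewrite mule0 => -[] /eqP.
  by rewrite eq_sym gt_eqF// exprn_gt0// disc_area_fine_gt0.
by rewrite gt0_mulye.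
Qed.

Lemma VolFS_gauss_prob (V : 'M[C]_n.+1) (d : seq R) (O : set (CP R n)) :
  V \is unitarymx -> size d = n.+1 ->
  (forall z, O (sigma z) <-> (0 < diag_form d (linC V (tcons (unit_plane R, z))))%R) ->
  VolFS O = VolFS [set: CP R n] * gauss_prob d 0.
Proof.
move=> uV sd OE; have := VolFS_diag uV sd OE; rewrite -VolFS_setT -muleA => h.
apply/eqP; rewrite eq_le; apply/andP.
by split; rewrite -(lee_pmul2l kappa_fin_num kappa_gt0) h.
Qed.

(** The characteristic polynomial determines the eigenvalues as a multiset only, so the spectral
    diagonal agrees with [d] up to order. Its entries are real because they occur among the embedded
    entries of [d]. *)
Lemma spectral_diag_seq (A : 'M[C]_n.+1) (d : seq R) : A \is hermsymmx ->
  char_poly A = (\prod_(x <- d) ('X - (x%:C%C)%:P))%R ->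
  exists2 d' : seq R, perm_eq d' d & exists2 P : 'M[C]_n.+1, P \is unitarymx &
    A = invmx P *m diag_mx (\row_i (d'`_i)%:C%C) *m P.
Proof.
move=> hA cA.
have [P uP [sp AE]] : exists2 P : 'M[C]_n.+1, P \is unitarymx &
    exists sp : 'rV[C]_n.+1, A = invmx P *m diag_mx sp *m P.
  exists (spectralmx A); first exact: spectral_unitarymx.
  by exists (spectral_diag A); exact/orthomx_spectralP/hermitian_normalmx.
have cD : char_poly A = (\prod_(x <- [seq sp 0%R i | i <- enum 'I_n.+1]) ('X - x%:P))%R.
  rewrite big_map big_enum /= AE.
  rewrite char_poly_similar ?unitarymx_unit//.
  rewrite char_poly_trig ?is_diag_mx_is_trig ?diag_mx_is_diag//.
  by apply: eq_bigr => i _; rewrite mxE eqxx.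
have pE : perm_eq [seq sp 0%R i | i <- enum 'I_n.+1] [seq (x%:C)%C | x <- d].
  by apply: prod_XsubC_eq; rewrite -cD cA big_map.
pose d' := [seq complex.Re (sp 0%R i) | i <- enum 'I_n.+1].
have spE (i : 'I_n.+1) : (d'`_i)%:C%C = sp 0%R i.
  rewrite (nth_map ord0) ?size_enum_ord// nth_ord_enum.
  have /mapP[x _ ->] // : sp 0%R i \in [seq (x%:C)%C | x <- d].
  by rewrite -(perm_mem pE) map_f// mem_enum.
exists d'.
  have Ed : [seq complex.Re x | x <- [seq (x%:C)%C | x <- d]] = d.
    by rewrite -map_comp -[RHS]map_id; exact: eq_map.
  by have := perm_map (@complex.Re R) pE; rewrite Ed -map_comp.
exists P; first exact: uP.
rewrite AE (_ : sp = \row_i (d'`_i)%:C%C)//.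
by apply/matrixP => i j; rewrite ord1 mxE spE.
Qed.

End projective.

(** * The volume formula *)

Lemma VolFS_Omega (R : realType) (n r : nat) (A : 'M[R[i]]_n.+1) (xs ys : seq R) :
  A \is hermsymmx ->
  (size xs + size ys + r)%N = n.+1 ->
  all (fun a => 0 < a) xs -> all (fun a => 0 < a) ys ->
  char_poly A = \prod_(x <- nseq r 0 ++ xs ++ map -%R ys) ('X - (x%:C%C)%:P) ->
  VolFS (Omega A) = (VolFS [set: CP R n] * (vol_num xs ys / vol_den xs ys)%:E)%E.
Proof.
move=> hA sz xs0 ys0 cA; have [d pd [P uP AE]] := spectral_diag_seq hA cA.
have sd : size d = n.+1.
  by rewrite (perm_size pd) !size_cat size_nseq size_map -sz addnC.
have uV : P *m rot_mx R n \is unitarymx by rewrite mul_unitarymx ?unitary_perm_mx.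
rewrite (VolFS_gauss_prob uV sd) => [|z]; last first.
  by rewrite sigma_preimage_Omega [in herm _ _]AE (herm_diag_form _ _ uP erefl) ltcR.
by rewrite (perm_gauss_prob _ pd) gauss_prob_vol.
Qed.

Theorem mainTheorem1 (R : realType) (n p q r : nat)
    (hn : (0 < n)%N) (hpqr : n.+1 = (p + q + r)%N) :
  (forall (A : 'M[R[i]]_n.+1) (mu : 'rV[R]_p) (nu : 'rV[R]_q),
     A \is hermsymmx ->
     (forall j, 0 < mu 0 j) ->
     (forall k, 0 < nu 0 k) ->
     char_poly A =
       (\prod_(j < p) ('X - ((mu 0 j)%:C%C)%:P))
       * (\prod_(k < q) ('X - ((- nu 0 k)%:C%C)%:P))
       * 'X^r ->
     VolFS (Omega A) =
       (VolFS [set: CP R n]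
        * (meval (fun i => row_mx mu nu 0 i) (Spoly R p q)
           / meval (fun i => row_mx mu nu 0 i) (Dpoly R p q))%:E)%E)
  /\ [/\ Spoly R p q \is ishomog1 (p * q) mdeg,
         Dpoly R p q \is ishomog1 (p * q) mdeg,
         (forall m, mcoeff m (Spoly R p q) \is a Num.nat)
       & (forall m, mcoeff m (Dpoly R p q) \is a Num.nat)].
Proof.
split; last first.
  split; [exact: dhomog_Spoly|exact: dhomog_Dpoly| |].
    by apply/mpolyOverP; exact: Spoly_over.
  by apply/mpolyOverP; exact: Dpoly_over.
move=> A mu nu hA mu0 nu0 cA; rewrite meval_Spoly meval_Dpoly.
have -> : xvals (fun i => row_mx mu nu 0 i) = [seq mu 0 j | j <- enum 'I_p].
  by apply: eq_map => j; rewrite row_mxEl.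
have -> : yvals (fun i => row_mx mu nu 0 i) = [seq nu 0 k | k <- enum 'I_q].
  by apply: eq_map => k; rewrite row_mxEr.
apply: (VolFS_Omega (r := r)) => //.
- by rewrite hpqr; congr (_ + _ + _)%N; rewrite size_map; exact: size_enum_ord.
- by apply/allP => _ /mapP[j _ ->].
- by apply/allP => _ /mapP[k _ ->].
have big_ord_enum m (f : 'I_m -> {poly R[i]}) :
    \prod_(i <- enum 'I_m) f i = \prod_(i < m) f i by rewrite big_enum.
rewrite cA !big_cat /= big_nseq iter_mulr_1 subr0 [RHS]mulrC; congr (_ * _ * _).
  by rewrite big_map; symmetry; exact: big_ord_enum.
by rewrite -map_comp [RHS]big_map; symmetry; exact: big_ord_enum.
Qed.
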